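(* Let $\pi_n$ be the unique stationary distribution of the gap process. There exist $\kappa\in(0,\infty)$ and $\beta\in(0,1)$ such that for every $t>0$, $$\sup_{\mathbf{y}\in\mathbb{R}_+^{n-1}}\|\mathbb{P}^t(\mathbf{y},\cdot)-\pi_n\|_{TV}\le\kappa\beta^t.$$
   Context: Fix $n\ge 2$ and a probability law $\theta$ on $(0,\infty)$ with $\int z\,\theta(dz)=1$. The $n$-particle Stochastic Follow-the-Leader system $\mathbf{X}=(X_1,\dots,X_n)$ on $\mathbb{R}$, with $X_n(t)<\dots<X_1(t)$, evolves as a pure jump Markov process: the leader $X_1$ jumps forward at rate $1$ with i.i.d. jump sizes of law $\theta$; for $i\ge 2$, particle $X_i$ jumps at rate $X_{i-1}-X_i$ to a location chosen uniformly in $(X_i,X_{i-1})$. The gap process is $Y_i(t)=X_i(t)-X_{i+1}(t)$, $i=1,\dots,n-1$; it is a Markov process on $\mathbb{R}_+^{n-1}$ whose generator acts on bounded measurable $f$ by $$\mathcal{L}_nf(\mathbf{y})=y_{n-1}\mathbb{E}_U[f(\mathbf{y}-y_{n-1}Ue_{n-1})-f(\mathbf{y})]+\sum_{i=1}^{n-2}y_i\mathbb{E}_U[f(\mathbf{y}+y_iU(e_{i+1}-e_i))-f(\mathbf{y})]+\mathbb{E}_\theta[f(\mathbf{y}+Ze_1)-f(\mathbf{y})],$$ where $U\sim\mathrm{U}(0,1)$, $Z\sim\theta$. $\mathbb{P}_{\mathbf{y}}$ denotes the law of $\mathbf{Y}$ started at $\mathbf{y}$ and $\mathbb{P}^t(\mathbf{y},A)=\mathbb{P}_{\mathbf{y}}(\mathbf{Y}(t)\in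 A)$. $\|\mu-\nu\|_{TV}=\sup_A|\mu(A)-\nu(A)|$. *)

(* Defs.v *)
From HB Require Import structures.
From mathcomp Require Import all_boot all_order all_algebra.
From mathcomp Require Import all_classical all_reals all_analysis measurable_realfun.
Set Implicit Arguments. Unset Strict Implicit. Unset Printing Implicit Defensive.
Import Order.TTheory GRing.Theory Num.Theory.
Local Open Scope classical_set_scope.
Local Open Scope ring_scope.

(* State space of the gap process: (n-1)-tuples of reals, with the product
   sigma-algebra (the library's measurable structure on tuples).
   Paper index i = 1..n-1  <->  ordinal index i-1 = 0..n-2. *)

Definition orthant (R : realType) (m : nat) (y : m.-tuple R) : Prop :=
  forall i : 'I_m, 0 <= tnth y i.

Definition shiftv (R : realType) (m : nat) (y : m.-tuple R) (f : 'I_m -> R)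
  : m.-tuple R := [tuple tnth y i + f i | i < m].

Definition jrate (R : realType) (m : nat) (y : m.-tuple R) : R :=
  1 + \sum_(i < m) y`_i.

Local Open Scope ereal_scope.
(* Rate-weighted jump operator: the jump part of the generator L_n, i.e.
   (Q f)(y) = y_{n-1} E_U[f(y - y_{n-1} U e_{n-1})]
            + sum_{i=1}^{n-2} y_i E_U[f(y + y_i U (e_{i+1} - e_i))]
            + E_theta[f(y + Z e_1)],  so that  L_n f = Q f - q f. *)
Definition jumpQ (R : realType) (m : nat) (theta : probability R R)
  (f : m.-tuple R -> \bar R) (y : m.-tuple R) : \bar R :=
  (y`_(m.-1))%:E *
     (\int[lebesgue_measure]_(u in `[0%R, 1%R]%classic)
        f (shiftv y (fun i => if val i == m.-1 then - (y`_(m.-1) * u) else 0)%R))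
  + (\sum_(j < m | (j.+1 < m)%N)
       (y`_j)%:E *
       (\int[lebesgue_measure]_(u in `[0%R, 1%R]%classic)
          f (shiftv y (fun i => if val i == val j then - (y`_j * u)
                               else if val i == (val j).+1 then y`_j * u
                               else 0)%R)))
  + (\int[theta]_z f (shiftv y (fun i => if val i == 0%N then z else 0%R))).

(* P is the transition function of the gap process: a family of probability
   kernels, jointly measurable in (t, y), satisfying the backward Kolmogorov
   integral equation of the pure jump process with generator L_n on the
   orthant.  Since the process is non-explosive, the minimal solution of this
   equation is honest, hence it is the unique family of probability kernels
   satisfying it, namely P^t(y, A) = P_y(Y(t) \in A). *)
Definition gap_transition (R : realType) (m : nat) (theta : probability R R)
  (P : R -> m.-tuple R -> probability (m.-tuple R) R) : Prop :=
  (forall A, measurable A ->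
     measurable_fun setT (fun p : R * m.-tuple R => P p.1 p.2 A)) /\
  (forall t y A, (0 <= t)%R -> orthant y -> measurable A ->
     P t y A =
       (expR (- (jrate y * t)))%:E * (\1_A y)%:E
       + \int[lebesgue_measure]_(s in `[0%R, t]%classic)
           ((expR (- (jrate y * s)))%:E *
              jumpQ theta (fun z => P (t - s)%R z A) y)).

Definition stationary (R : realType) (m : nat)
  (P : R -> m.-tuple R -> probability (m.-tuple R) R)
  (pi : probability (m.-tuple R) R) : Prop :=
  pi (@orthant R m) = 1 /\
  forall t A, (0 <= t)%R -> measurable A ->
    \int[pi]_y P t y A = pi A.

Definition sup_tv (R : realType) (m : nat)
  (P : R -> m.-tuple R -> probability (m.-tuple R) R)
  (pi : probability (m.-tuple R) R) (t : R) : \bar R :=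
  ereal_sup [set e | exists y A, orthant y /\ measurable A /\
                                 e = `| P t y A - pi A |].

(* Main.v *)
(* The total jump rate [q] is one plus the span of the configuration, and the
   generator raises it by at most one, so bounded solutions of the backward
   equation obey a comparison principle: perturb by [- de (q + s)] to confine a
   would-be violation to bounded rates, where one application of the integral
   equation shrinks it by a fixed factor. Three consequences follow.
   - If [P T z A >= a] for every state [z], then [P (T + s) z A >= a].
   - Coming down from infinity: the partial sum [y_0 + ... + y_k] is moved only
     by the leader and by one follower, so with [f x = x / (L + x)] the bounded
     function summing [f (y_0 + ... + y_k)] over [k] has generator at most [-1]
     outside a compact set; hence a gain over [a] available on that set is
     available, up to a constant, from every state.
   - Minorization: rate [y_j] times the uniform density [1 / y_j] is [1], so
     after one macroscopic jump of the leader the followers, jumping in order,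
     put the gaps at any point of a small cube with a density bounded below
     independently of the starting state.
   Applied to [A] and to its complement, this contracts the oscillation of
   [P t . A] by a fixed factor per unit of time. The stationary law is an average
   of [P t y A] over [y], so it always lies within that oscillation. *)
Require Import Defs.
From HB Require Import structures.
From mathcomp Require Import all_boot all_order all_algebra.
From mathcomp Require Import all_classical all_reals all_analysis measurable_realfun.
From mathcomp Require Import ring lra zify.
Import Order.TTheory GRing.Theory Num.Theory.
Import numFieldNormedType.Exports.
Local Open Scope classical_set_scope.
Local Open Scope ring_scope.

(** * Integration *)

Section integral_tools.
Local Open Scope ereal_scope.
Context d (T : measurableType d) (R : realType).
Variable mu : {measure set T -> \bar R}.

(* The integral of a nonnegative function is a supremum over simple functions
   below it, so monotonicity needs no measurability. *)
Lemma ge0_integral_lower (D : set T) (h f : T -> \bar R) :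
  (forall x, D x -> 0 <= f x) -> (forall x, D x -> h x <= f x) ->
  \int[mu]_(x in D) h x <= \int[mu]_(x in D) f x.
Proof.
move=> f0 hf; apply: (@le_trans _ _ (\int[mu]_(x in D) h^\+ x)).
  by rewrite integralE geeDl// oppe_le0 integral_ge0.
rewrite integral_mkcond [leRHS]integral_mkcond.
have h0 x : 0 <= (h^\+ \_ D) x by rewrite patchE; case: ifP.
have f0' x : 0 <= (f \_ D) x.
  by rewrite patchE; case: ifPn => //; rewrite inE => /f0.
rewrite !ge0_integralTE//; apply: le_ereal_sup => _ [g /= gh <-].
exists g => // x; apply: (le_trans (gh x)).
rewrite !patchE; case: ifPn => //; rewrite inE => Dx.
by rewrite funeposE ge_max hf// f0.
Qed.

End integral_tools.

Section affine_change_of_variables.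
Local Open Scope ereal_scope.
Context (R : realType).
Notation mu := (@lebesgue_measure R).

Definition affine_map (c b x : R) : measurableTypeR R := (c * x + b)%R.

Lemma measurable_affine c b : measurable_fun setT (affine_map c b : measurableTypeR R -> _).
Proof. by apply: measurable_funD => //; apply: measurable_funM. Qed.

(** Lebesgue measure is determined by its values on half-open intervals, and the pushforward along
    the map, scaled by [c], gives each of them its length. *)
Lemma lebesgue_measure_affine (c b : R) (c0 : (0 < c)%R) (A : set R) :
  measurable A ->
  mu A = c%:E * mu (affine_map c b @^-1` A).
Proof.
move=> mA.
pose phi : {mfun measurableTypeR R >-> measurableTypeR R} :=
  HB.pack (affine_map c b) (isMeasurableFun.Build _ _ _ _ _ (measurable_affine c b)).
have c0' : (0 <= c)%R by exact: ltW.
rewrite (@lebesgue_measure_unique R (mscale (NngNum c0') (pushforward mu phi)))//=.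
move=> _ [[x y]] _ <-.
rewrite /mscale /pushforward/=.
rewrite -[X in _ * mu X](_ : `]((x - b) / c)%R, ((y - b) / c)%R]%classic = _); last first.
  apply/seteqP; split => z /=; rewrite !in_itv/= /affine_map;
    by rewrite ltr_pdivrMr// ler_pdivlMr// (mulrC z) ltrBlDr lerBrDr.
rewrite !lebesgue_measure_itv/= !lte_fin ltr_pM2r ?invr_gt0// ltrD2r.
case: ifPn => _; last by rewrite mule0.
by rewrite -!EFinB -EFinM; congr EFin; field; apply: lt0r_neq0.
Qed.

Lemma ge0_integral_affine (c b : R) (c0 : (0 < c)%R) (D : set R) (f : R -> \bar R) :
  measurable D -> measurable_fun D f -> (forall x, D x -> 0 <= f x) ->
  \int[mu]_(x in D) f x =
  c%:E * \int[mu]_(x in affine_map c b @^-1` D) f (affine_map c b x).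
Proof.
move=> mD mf f0.
pose phi : {mfun measurableTypeR R >-> measurableTypeR R} :=
  HB.pack (affine_map c b) (isMeasurableFun.Build _ _ _ _ _ (measurable_affine c b)).
have c0' : (0 <= c)%R by exact: ltW.
have mphi : measurable_fun setT phi by exact: measurable_affine.
pose nu : {measure set _ -> \bar R} := mscale (NngNum c0') (pushforward mu phi).
transitivity (\int[nu mphi]_(x in D) f x).
  by apply: eq_measure_integral => A mA _; exact: lebesgue_measure_affine.
by rewrite ge0_integral_mscale// ge0_integral_pushforward// => x /[!inE]/f0.
Qed.

Lemma ge0_integral_shift (s t : R) (f : R -> \bar R) :
  measurable_fun setT f -> (forall x, 0 <= f x) ->
  \int[mu]_(x in `[s, (s + t)%R]) f x = \int[mu]_(x in `[0%R, t]) f (s + x)%R.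
Proof.
move=> mf f0; rewrite (@ge0_integral_affine 1 s)//; last exact: measurable_funTS.
rewrite mul1e (_ : affine_map 1 s @^-1` _ = `[0%R, t]%classic); last first.
  by apply/seteqP; split => z /=; rewrite !in_itv/= /affine_map; lra.
by apply: eq_integral => x _; rewrite /affine_map mul1r addrC.
Qed.

Lemma ge0_integral_scale (a : R) (f : R -> \bar R) : (0 < a)%R ->
  measurable_fun setT f -> (forall x, 0 <= f x) ->
  \int[mu]_(x in `[0%R, a]) f x = a%:E * \int[mu]_(x in `[0%R, 1%R]) f (a * x)%R.
Proof.
move=> a0 mf f0; rewrite (@ge0_integral_affine a 0)//; last exact: measurable_funTS.
rewrite (_ : affine_map a 0 @^-1` _ = `[0%R, 1%R]%classic); last first.
  apply/seteqP; split => z /=; rewrite !in_itv/= /affine_map addr0 => /andP[h1 h2].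
    by apply/andP; split; nra.
  by apply/andP; split; nra.
by congr (_ * _); apply: eq_integral => x _; rewrite /affine_map addr0.
Qed.

(** Passes from the fraction [u] that a gap loses to the fraction [1 - u] that it keeps. Reflection
    preserves Lebesgue measure, and a unit shift brings [-1, 0] back to [0, 1]. *)
Lemma ge0_integral_onem (f : R -> \bar R) :
  measurable_fun setT f -> (forall x, 0 <= f x) ->
  \int[mu]_(x in `[0%R, 1%R]) f x = \int[mu]_(x in `[0%R, 1%R]) f (1 - x)%R.
Proof.
move=> mf f0.
have mN : measurable_fun setT (-%R : measurableTypeR R -> measurableTypeR R).
  exact: oppr_measurable.
have mfN : measurable_fun setT (fun x : measurableTypeR R => f (- x)%R).
  exact: (measurableT_comp mf mN).
transitivity (\int[mu]_(x in `[(-1)%R, (-1 + 1)%R]) f (- x)%R).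
  transitivity (\int[pushforward mu (-%R : _ -> measurableTypeR R)]_(x in `[0%R, 1%R]) f x).
    by apply: eq_measure_integral => A mA _; exact/esym/lebesgue_measureN.
  rewrite ge0_integral_pushforward//; last exact: measurable_funTS.
  rewrite (_ : -%R @^-1` _ = `[(-1)%R, (-1 + 1)%R]%classic)//.
  by apply/seteqP; split => z /=; rewrite !in_itv/=; lra.
rewrite (ge0_integral_shift _ _ _ mfN)//; apply: eq_integral => x _.
by congr f; lra.
Qed.

End affine_change_of_variables.

Section param_integral.
Local Open Scope ereal_scope.

(** Measurability of Tonelli's partial integrals, once the domain [D] is turned into an indicator
    factor of the integrand. *)
Lemma measurable_integral_param d1 d2 (T1 : measurableType d1)
    (T2 : measurableType d2) (R : realType)
    (mu : {sigma_finite_measure set T2 -> \bar R}) (D : set T2)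
    (g : T1 -> T2 -> \bar R) :
  measurable D -> measurable_fun setT (fun p => g p.1 p.2) ->
  (forall x u, 0 <= g x u) ->
  measurable_fun setT (fun x => \int[mu]_(u in D) g x u).
Proof.
move=> mD mg g0.
rewrite (_ : (fun x => _) =
    fubini_F mu (fun p => g p.1 p.2 * (\1_D p.2)%:E)); last first.
  apply/funext => x; rewrite integral_mkcond /fubini_F.
  apply: eq_integral => u _ /=.
  by rewrite patchE indicE/=; case: ifP; rewrite ?mule1 ?mule0.
apply: measurable_fun_fubini_tonelli_F => [|p]; last first.
  by rewrite mule_ge0// lee_fin.
apply: emeasurable_funM => //; apply/measurable_EFinP.
by apply: measurableT_comp => //; exact: measurable_indic.
Qed.

Lemma integral01_affine (R : realType) (al be : R) :
  \int[lebesgue_measure]_(u in `[0%R, 1%R]) (al + be * u)%:E = (al + be / 2)%:E.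
Proof.
pose F u : R := (al * u + be / 2 * (u * u))%R.
have dF (x : R) : is_derive x 1%R F (al + be * x)%R.
  rewrite /F; apply: is_derive_eq.
  by rewrite /GRing.scale/=; lra.
rewrite (@continuous_FTC2 _ (fun u => al + be * u)%R F)//.
- by rewrite /F -EFinB; congr EFin; lra.
- apply: continuous_subspaceT => x; apply: continuousD; first exact: cvg_cst.
  by apply: continuousM; [exact: cvg_cst|exact: cvg_id].
- split=> [x _||].
  + by have [] := dF x.
  + apply: cvg_at_right_filter; apply: differentiable_continuous.
    by apply/derivable1_diffP; have [] := dF 0%R.
  + apply: cvg_at_left_filter; apply: differentiable_continuous.
    by apply/derivable1_diffP; have [] := dF 1%R.
- by move=> x _; rewrite derive1E derive_val.
Qed.

(** The mean is given as an integral over the whole line. Since [theta] charges only positive reals,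
    the negative part integrates to 0 and the mean over the open half-line is still 1. *)
Lemma integral_pos_mean_affine (R : realType) (theta : probability R R) (al be : R) :
  theta `]0%R, +oo[%classic = 1 -> \int[theta]_z z%:E = 1 ->
  \int[theta]_(z in `]0%R, +oo[) (al + be * z)%:E = (al + be)%:E.
Proof.
move=> th0 th1; set D : set R := `]0%R, +oo[%classic.
have mD : measurable D by exact: measurable_itv.
have mE : measurable_fun setT (EFin : R -> \bar R) by exact/measurable_EFinP.
have thN : theta (~` D) = 0 by rewrite probability_setC// th0 subee.
have neg0 : \int[theta]_z (EFin^\- z) = 0.
  rewrite (@ge0_negligible_integral _ _ _ _ _ (~` D))//.
  - rewrite setTD setCK; apply: integral0_eq => z.
    by rewrite /D/= in_itv/= andbT funenegE => z0; apply/max_idPr; rewrite oppe_le0 lee_fin ltW.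
  - exact: measurableC.
  - exact: measurable_funeneg.
have D1 : \int[theta]_(z in D) z%:E = 1.
  rewrite -[RHS]th1 [in RHS]integralE neg0 sube0.
  rewrite (@ge0_negligible_integral _ _ _ _ setT (~` D))//.
  - rewrite setTD setCK; apply: eq_integral => z.
    rewrite inE /D/= in_itv/= andbT funeposE => z0; apply/esym/max_idPl.
    by rewrite lee_fin ltW.
  - exact: measurableC.
  - exact: measurable_funepos.
have iD : theta.-integrable D EFin.
  apply/integrableP; split; first exact: measurable_funTS.
  rewrite (_ : integral _ _ _ = 1) ?ltry// -[RHS]D1; apply: eq_integral => z.
  by rewrite inE /D/= in_itv/= andbT => z0; rewrite gtr0_norm.
have ic : theta.-integrable D (fun=> al%:E).
  apply: finite_measure_integrable_cst => //.
under eq_integral do rewrite EFinD EFinM.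
rewrite integralD//; last exact: integrableZl.
rewrite (integral_cst _ mD) integralZl//.
by rewrite D1 [X in _ * X + _]th0 !mule1 EFinD.
Qed.

End param_integral.

(** * Jumps of the gap process *)

Section moves.
Context {R : realType} {m : nat}.
Implicit Types (y : m.-tuple R).

(* The gap of index [j] loses the fraction [u] to the next one; for the last gap
   the second branch is void, so the last particle needs no separate case. *)
Definition follow y (j : nat) (u : R) : m.-tuple R :=
  shiftv y (fun i => if val i == j then - (y`_j * u)
                     else if val i == j.+1 then y`_j * u else 0).

Definition lead y (z : R) : m.-tuple R :=
  shiftv y (fun i => if val i == 0%N then z else 0).

(* In particle positions this is X_1 - X_(k+2). *)
Definition psum y (k : nat) : R := \sum_(i < m | (i <= k)%N) tnth y i.

Lemma measurable_follow y j : measurable_fun setT (follow y j).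
Proof.
apply/measurable_fun_tnthP => i.
rewrite (_ : _ \o _ = fun u => tnth y i + (if val i == j then - (y`_j * u)
                     else if val i == j.+1 then y`_j * u else 0)); last first.
  by apply/funext => u; rewrite /= tnth_mktuple.
apply: measurable_funD => //; case: (val i == j).
  by apply: measurableT_comp => //; apply: measurable_funM.
by case: (val i == j.+1) => //; apply: measurable_funM.
Qed.

Lemma measurable_lead y : measurable_fun setT (lead y).
Proof.
apply/measurable_fun_tnthP => i.
rewrite (_ : _ \o _ = fun u => tnth y i + (if val i == 0%N then u else 0)); last first.
  by apply/funext => u; rewrite /= tnth_mktuple.
by apply: measurable_funD => //; case: (val i == 0%N).
Qed.

Lemma jrate_psum y k : (m.-1 <= k)%N -> jrate y = 1 + psum y k.
Proof.
move=> mk; rewrite /jrate /psum; congr (_ + _).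
rewrite [RHS]big_mkcond; apply: eq_bigr => i _.
by rewrite (tnth_nth 0) (leq_trans _ mk)// -ltnS (leq_trans (ltn_ord i))// leqSpred.
Qed.

Lemma nth_ge0 y j : orthant y -> 0 <= y`_j.
Proof.
move=> y0; have [jm|mj] := ltnP j m; last by rewrite nth_default// size_tuple.
by rewrite -(tnth_nth 0 y (Ordinal jm)).
Qed.

Lemma psum_ge0 y k : orthant y -> 0 <= psum y k.
Proof. by move=> y0; apply: sumr_ge0 => i _. Qed.

Lemma psum_le y j k : orthant y -> (j <= k)%N -> psum y j <= psum y k.
Proof.
move=> y0 jk; rewrite /psum big_mkcond [leRHS]big_mkcond.
apply: ler_sum => i _; case: ifP => // ij; first by rewrite (leq_trans ij jk).
by case: ifP.
Qed.

Lemma jrate_ge1 y : orthant y -> 1 <= jrate y.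
Proof. by move=> y0; rewrite (@jrate_psum _ m.-1)// lerDl psum_ge0. Qed.

Lemma nth_le_psum y j k : orthant y -> (j <= k)%N -> y`_j <= psum y k.
Proof.
move=> y0 jk; have [jm|mj] := ltnP j m; last first.
  by rewrite nth_default ?size_tuple// psum_ge0.
rewrite /psum (bigD1 (Ordinal jm))//= (tnth_nth 0) lerDl.
by apply: sumr_ge0 => i _.
Qed.

(** What gap [j] loses is returned by gap [j.+1], so a partial sum changes only if it stops exactly
    between the two. For the last gap the total itself drops. *)
Lemma psum_follow y j u k : (j < m)%N -> (k < m)%N ->
  psum (follow y j u) k = psum y k - (if k == j then y`_j * u else 0).
Proof.
move=> jm km; rewrite /psum.
under eq_bigr do rewrite tnth_mktuple.
rewrite big_split/=; congr (_ + _).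
rewrite big_mkcond/= (bigD1 (Ordinal jm))//= eqxx.
(* The contribution of gap [j.+1], present only if that gap exists and is counted in the sum. *)
have -> : \sum_(i < m | i != Ordinal jm) (if (i <= k)%N then
     if val i == j then - (y`_j * u) else if val i == j.+1 then y`_j * u else 0
   else 0) = if (j.+1 < m)%N && (j.+1 <= k)%N then y`_j * u else 0.
  case: ifPn => [/andP[j1m j1k]|].
    rewrite (bigD1 (Ordinal j1m))/=; last by rewrite -val_eqE/= gtn_eqF.
    rewrite j1k gtn_eqF// eqxx big1 ?addr0// => i /andP[].
    by rewrite -!val_eqE/= => /negbTE-> /negbTE->; rewrite if_same.
  rewrite negb_and -!leqNgt => H; apply: big1 => i.
  rewrite -val_eqE/= => /negbTE->; case: ifP => // ik; case: ifP => // /eqP ij.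
  by move: H; rewrite -ij leqNgt ltn_ord /= => kj; move: ik; rewrite ij ltnNge kj.
have [jk|kj|->] := ltngtP j k.
- by rewrite (leq_ltn_trans jk km) oppr0 addNr.
- by rewrite andbF addr0 oppr0.
- by rewrite andbF addr0.
Qed.

Lemma psum_lead y z k : (0 < m)%N -> psum (lead y z) k = psum y k + z.
Proof.
move=> m0; rewrite /psum.
under eq_bigr do rewrite tnth_mktuple.
rewrite big_split/=; congr (_ + _).
rewrite (bigD1 (Ordinal m0))//= big1 ?addr0// => i /andP[_].
by rewrite -val_eqE/= => /negbTE->.
Qed.

Lemma orthant_follow y j u : orthant y -> 0 <= u <= 1 -> orthant (follow y j u).
Proof.
move=> y0 /andP[u0 u1] i; rewrite tnth_mktuple; have yj := nth_ge0 _ j y0.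
case: ifP => [/eqP ij|_]; first by rewrite (tnth_nth 0) ij; nra.
by have := y0 i; case: ifP => _ yi; nra.
Qed.

Lemma orthant_lead y z : orthant y -> 0 < z -> orthant (lead y z).
Proof.
by move=> y0 z0 i; rewrite tnth_mktuple; have := y0 i; case: ifP => _; lra.
Qed.

Local Open Scope ereal_scope.

Lemma jumpQE (theta : probability R R) (f : m.-tuple R -> \bar R) y : (0 < m)%N ->
  jumpQ theta f y =
  \sum_(j < m) (y`_j)%:E * \int[lebesgue_measure]_(u in `[0%R, 1%R]) f (follow y j u)
  + \int[theta]_z f (lead y z).
Proof.
move=> m0; have mm : (m.-1 < m)%N by rewrite prednK.
rewrite /jumpQ [in RHS](bigD1 (Ordinal mm))//=; congr (_ + _ + _).
  congr (_ * _); apply: eq_integral => u _; congr f; congr shiftv; apply/funext => i.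
  have -> : (val i == m.-1.+1) = false by rewrite prednK// (ltn_eqF (ltn_ord i)).
  by [].
apply: eq_bigl => j; rewrite -val_eqE/=; have jm := ltn_ord j; lia.
Qed.

Lemma jumpQ_lower (theta : probability R R) (f : m.-tuple R -> \bar R) y
    (I_ : 'I_m -> R) (I0 : R) : (0 < m)%N -> orthant y ->
  (forall j : 'I_m, (I_ j)%:E <=
    \int[lebesgue_measure]_(u in `[0%R, 1%R]) f (follow y j u)) ->
  I0%:E <= \int[theta]_z f (lead y z) ->
  (\sum_(j < m) y`_j * I_ j + I0)%:E <= jumpQ theta f y.
Proof.
move=> m0 y0 hI hI0; rewrite jumpQE// EFinD leeD//.
rewrite -sumEFin; apply: lee_sum => j _.
by rewrite EFinM lee_wpmul2l// lee_fin nth_ge0.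
Qed.

Lemma integral_pos_mean_lower (theta : probability R R) (f : R -> \bar R) (al be : R) :
  theta `]0%R, +oo[%classic = 1 -> \int[theta]_z z%:E = 1 ->
  (forall z, 0 <= f z) -> (forall z, (0 < z)%R -> (al + be * z)%:E <= f z) ->
  (al + be)%:E <= \int[theta]_z f z.
Proof.
move=> th0 th1 f0 hf; rewrite -(integral_pos_mean_affine _ _ _ _ th0 th1).
apply: (@le_trans _ _ (\int[theta]_(z in `]0%R, +oo[) f z)).
  apply: ge0_integral_lower => // z; rewrite /= in_itv/= andbT; exact: hf.
rewrite integral_mkcond; apply: ge0_integral_lower => // z _.
by rewrite patchE; case: ifP.
Qed.

Lemma integral01_lower (f : R -> \bar R) (al be : R) :
  (forall u, 0 <= f u) -> (forall u, (0 <= u <= 1)%R -> (al + be * u)%:E <= f u) ->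
  (al + be / 2)%:E <= \int[lebesgue_measure]_(u in `[0%R, 1%R]) f u.
Proof.
move=> f0 hf; rewrite -integral01_affine; apply: ge0_integral_lower => // u.
Qed.

End moves.

(** * Comparison principle *)

(** Variation of constants: v(s) = al + be * s satisfies v(s) = e^(-qs) v(0) plus the integral over
    r in [0, s] of e^(-qr) (q v + v')(s - r). Hence an affine function of time can be compared with
    the backward equation. *)
Lemma integral_exp_affine (R : realType) (q al be s : R) : 0 <= s ->
  (\int[lebesgue_measure]_(r in `[0%R, s])
     (expR (- (q * r)) * (q * (al + be * (s - r)) + be))%:E
   = (al + be * s - expR (- (q * s)) * al)%:E)%E.
Proof.
rewrite le_eqVlt => /predU1P[<-|s0].
  by rewrite set_itv1 integral_set1 !mulr0 oppr0 expR0; congr EFin; lra.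
pose F r : R := - (expR (- (q * r)) * (al + be * (s - r))).
have dF (x : R) : is_derive x 1%R F
    (expR (- (q * x)) * (q * (al + be * (s - x)) + be)).
  rewrite /F; apply: is_derive_eq.
  by rewrite /GRing.scale/=; lra.
rewrite (@continuous_FTC2 _ _ F)//.
- by rewrite /F -EFinB; congr EFin; rewrite !mulr0 oppr0 expR0; lra.
- apply: continuous_subspaceT => x.
  apply: differentiable_continuous; apply/derivable1_diffP.
  by [].
- split=> [x _||].
  + by have [] := dF x.
  + apply: cvg_at_right_filter; apply: differentiable_continuous.
    by apply/derivable1_diffP; have [] := dF 0%R.
  + apply: cvg_at_left_filter; apply: differentiable_continuous.
    by apply/derivable1_diffP; have [] := dF s.
- by move=> x _; rewrite derive1E derive_val.
Qed.

Lemma ge0_integral_concat (R : realType) (s t : R) (F : R -> \bar R) :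
  0 <= s -> 0 <= t -> measurable_fun setT F -> (forall x, (0 <= F x)%E) ->
  (\int[lebesgue_measure]_(x in `[0%R, (t + s)%R]) F x =
   \int[lebesgue_measure]_(x in `[0%R, s]) F x +
   \int[lebesgue_measure]_(x in `[0%R, t]) F (s + x)%R)%E.
Proof.
move=> s0 t0 mF F0.
have -> : `[0%R, (t + s)%R]%classic = `[0%R, s] `|` `]s, (s + t)%R]%classic.
  by rewrite (addrC t) -itv_bndbnd_setU// bnd_simp ?lerDl.
rewrite ge0_integral_setU//; last 2 first.
- exact: measurable_funTS.
- by apply/disj_setPS => x/= []; rewrite !in_itv/=; lra.
rewrite integral_itv_obnd_cbnd; last exact: measurable_funTS.
by rewrite ge0_integral_shift.
Qed.

Section transition.
Context {R : realType} {m : nat} (theta : probability R R)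
  (P : R -> m.-tuple R -> probability (m.-tuple R) R)
  (m0 : (0 < m)%N) (th0 : theta `]0%R, +oo[%classic = 1%E)
  (th1 : (\int[theta]_z z%:E = 1)%E) (hP : gap_transition theta P).
Implicit Types (y : m.-tuple R) (A : set (m.-tuple R)).
Local Open Scope ereal_scope.

Lemma measurable_jumpQ_time A y (T : R) : measurable A ->
  measurable_fun setT (fun r : R => jumpQ theta (fun z => P (T - r)%R z A) y).
Proof.
move=> mA; have mP := hP.1 A mA.
under eq_fun do rewrite jumpQE//.
apply: emeasurable_funD.
  apply: emeasurable_sum => j; apply: emeasurable_funM => //.
  apply: measurable_integral_param => //.
  have mg : measurable_fun setT
      (fun p : R * measurableTypeR R => ((T - p.1)%R, follow y j p.2)).
    apply/measurable_fun_pairP; split => /=.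
      by apply: measurable_funB => //; exact: measurable_fst.
    exact: (measurableT_comp (measurable_follow y j) measurable_snd).
  exact: (measurableT_comp mP mg).
apply: measurable_integral_param => //.
have mg : measurable_fun setT (fun p : R * R => ((T - p.1)%R, lead y p.2)).
  apply/measurable_fun_pairP; split => /=.
    by apply: measurable_funB => //; exact: measurable_fst.
  exact: (measurableT_comp (measurable_lead y) measurable_snd).
exact: (measurableT_comp mP mg).
Qed.

Lemma jumpQ_ge0 (f : m.-tuple R -> \bar R) y : orthant y -> (forall z, 0 <= f z) ->
  0 <= jumpQ theta f y.
Proof.
move=> y0 f0; rewrite jumpQE//; apply: adde_ge0; last exact: integral_ge0.
apply: sume_ge0 => j _; apply: mule_ge0; last exact: integral_ge0.
by rewrite lee_fin nth_ge0.
Qed.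

(** The backward equation with the first jump observed only up to time [s]. Beyond [s] the factor
    e^(-qs) comes out of the integral, and what remains is the equation at time [T]. *)
Lemma transition_restart A y (T s : R) : measurable A -> orthant y ->
  (0 <= T)%R -> (0 <= s)%R ->
  P (T + s)%R y A = (expR (- (jrate y * s)))%:E * P T y A +
    \int[lebesgue_measure]_(r in `[0%R, s])
      ((expR (- (jrate y * r)))%:E * jumpQ theta (fun z => P (T + s - r)%R z A) y).
Proof.
move=> mA y0 T0 s0; rewrite (hP.2 _ _ _ (addr_ge0 T0 s0) y0 mA) (hP.2 _ _ _ T0 y0 mA).
set F := fun r => _ * jumpQ theta (fun z => P (T + s - r)%R z A) y.
have F0 r : 0 <= F r.
  by apply: mule_ge0; [rewrite lee_fin expR_ge0|apply: jumpQ_ge0].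
have mF : measurable_fun setT F.
  apply: emeasurable_funM; last exact: measurable_jumpQ_time.
  apply/measurable_EFinP; apply: measurableT_comp => //.
  by apply: measurableT_comp => //; apply: measurable_funM.
rewrite ge0_integral_concat//.
rewrite ge0_muleDr; last 2 first.
- by rewrite mule_ge0// lee_fin ?expR_ge0.
- apply: integral_ge0 => r _; apply: mule_ge0; [by rewrite lee_fin expR_ge0|exact: jumpQ_ge0].
rewrite -[RHS]addeA [X in _ = _ + X]addeC; congr (_ + (_ + _)).
  by rewrite muleA; congr (_ * _); rewrite -EFinM -expRD -opprD -mulrDr (addrC s).
rewrite -ge0_integralZl//; last 2 first.
- apply: measurable_funTS; apply: emeasurable_funM; last exact: measurable_jumpQ_time.
  apply/measurable_EFinP; apply: measurableT_comp => //.
  by apply: measurableT_comp => //; apply: measurable_funM.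
- by move=> r _; apply: mule_ge0; [rewrite lee_fin expR_ge0|exact: jumpQ_ge0].
apply: eq_integral => r _; rewrite /F muleA -EFinM -expRD -opprD -mulrDr.
by congr (_ * jumpQ _ _ _); apply/funext => z; congr (P _ z A); lra.
Qed.

Lemma transition_lower A y (T s p al be : R) : measurable A -> orthant y ->
  (0 <= T)%R -> (0 <= s)%R -> p%:E <= P T y A ->
  (forall r, (0 <= r <= s)%R -> (jrate y * (al + be * (s - r)) + be)%:E <=
     jumpQ theta (fun z => P (T + s - r)%R z A) y) ->
  (al + be * s + expR (- (jrate y * s)) * (p - al))%:E <= P (T + s)%R y A.
Proof.
move=> mA y0 T0 s0 hp hQ; rewrite transition_restart//.
rewrite (_ : (_ + _)%R = (expR (- (jrate y * s)) * p +
  (al + be * s - expR (- (jrate y * s)) * al))%R); last by lra.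
rewrite EFinD; apply: leeD.
  by rewrite EFinM lee_wpmul2l// lee_fin expR_ge0.
rewrite -integral_exp_affine//; apply: ge0_integral_lower => r; rewrite /= in_itv/= => rs.
  by apply: mule_ge0; [rewrite lee_fin expR_ge0|exact: jumpQ_ge0].
by rewrite EFinM lee_wpmul2l// ?lee_fin ?expR_ge0//; exact: hQ.
Qed.

(* The generator of [chi] at [y] is at least [be], witnessed by bounds that are
   affine along each jump, so that [chi] itself need not be integrated. *)
Definition drift_ge (chi : m.-tuple R -> R) y (be : R) : Prop :=
  exists (e_ : 'I_m -> R) (e : R),
    [/\ forall (j : 'I_m) u, (0 <= u <= 1)%R -> (chi y + e_ j * u <= chi (follow y j u))%R,
        forall z, (0 < z)%R -> (chi y - e * z <= chi (lead y z))%R &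
        (be <= \sum_(j < m) y`_j * (e_ j / 2) - e)%R].

Lemma jrate_follow y (j : 'I_m) u : orthant y -> (0 <= u <= 1)%R ->
  (jrate (follow y j u) <= jrate y)%R.
Proof.
move=> y0 /andP[u0 u1]; rewrite !(@jrate_psum _ _ _ m.-1)// psum_follow//; last first.
  by rewrite prednK.
by case: ifP => _; have := nth_ge0 _ j y0; nra.
Qed.

Lemma jrate_lead y z : jrate (lead y z) = (jrate y + z)%R.
Proof. by rewrite !(@jrate_psum _ _ _ m.-1)// psum_lead// addrA. Qed.

Lemma jrateE y : jrate y = (1 + \sum_(j < m) y`_j)%R.
Proof. by []. Qed.

(** One application of the integral equation to a bound known up to a deficit [N]. Where
    [jrate y > K] the perturbed bound is nonpositive and there is nothing to prove. Elsewhere the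
    state stays put with probability at least e^(-K Tm), and on that event no deficit is
    incurred. *)
Lemma comparison_step A (T Tm : R) (chi : m.-tuple R -> R) (be M de N K : R) :
  measurable A -> (0 <= T)%R -> (0 < de)%R -> (0 <= N)%R -> (0 <= K)%R -> (0 <= Tm)%R ->
  (forall y, orthant y -> (chi y <= M)%R) ->
  (M + `|be| * Tm <= de * K)%R ->
  (forall y, orthant y ->
     (forall s, (0 <= s <= Tm)%R -> (chi y + be * s)%:E <= P (T + s)%R y A) \/
     ((chi y)%:E <= P T y A /\ drift_ge chi y be)) ->
  (forall s y, (0 <= s <= Tm)%R -> orthant y ->
     (chi y - de * jrate y + (be - de) * s - N)%:E <= P (T + s)%R y A) ->
  forall s y, (0 <= s <= Tm)%R -> orthant y ->
     (chi y - de * jrate y + (be - de) * s - N * (1 - expR (- (K * Tm))))%:E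
       <= P (T + s)%R y A.
Proof.
move=> mA T0 de0 N0 K0 Tm0 chiM hK hchi hN s y /andP[s0 sTm] y0.
have q1 := jrate_ge1 _ y0.
have hrho : (0 <= N * (1 - expR (- (K * Tm))))%R.
  by rewrite mulr_ge0// subr_ge0 -expR0 ler_expR oppr_le0 mulr_ge0.
have [neg|pos] := leP (chi y - de * jrate y + (be - de) * s)%R 0%R.
  apply: (@le_trans _ _ 0) => //; rewrite lee_fin; lra.
have bes : (be * s <= `|be| * Tm)%R.
  by apply: (le_trans (ler_norm _)); rewrite normrM ler_wpM2l// ger0_norm.
have qK : (jrate y <= K)%R.
  rewrite -(ler_pM2l de0); apply: le_trans hK.
  by have := chiM _ y0; nra.
have [h|[h0 [e_ [e [he hl hb]]]]] := hchi _ y0.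
  apply: le_trans (h s _); last by rewrite s0.
  by rewrite lee_fin; nra.
pose al := (chi y - de * jrate y - N)%R.
apply: (@le_trans _ _ (al + (be - de) * s + expR (- (jrate y * s)) * (chi y - al))%:E).
  have hexp : (expR (- (K * Tm)) <= expR (- (jrate y * s)))%R.
    by rewrite ler_expR lerN2; apply: ler_pM => //; lra.
  have := expR_ge0 (- (jrate y * s)); rewrite lee_fin /al => h1.
  have : (0 <= expR (- (jrate y * s)) * (de * jrate y))%R.
    by rewrite mulr_ge0// mulr_ge0; lra.
  nra.
apply: transition_lower => // r /andP[r0 rs].
have rTm : (0 <= s - r <= Tm)%R by apply/andP; split; lra.
(* The slope is [be - de] because a leader jump raises [jrate] by 1 on average, which costs [de];
   follower jumps never raise it. *)
pose al' := (al + (be - de) * (s - r))%R.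
apply: (@le_trans _ _ (\sum_(j < m) y`_j * (al' + e_ j / 2) + (al' + - (e + de)))%:E).
  rewrite lee_fin; under eq_bigr do rewrite mulrDr.
  rewrite big_split/= -mulr_suml jrateE -/al'; lra.
apply: jumpQ_lower => // [j|].
  apply: integral01_lower => // u u01.
  rewrite -(addrA T s); apply: le_trans (hN (s - r)%R _ rTm _); last exact: orthant_follow.
  rewrite lee_fin; have := he j u u01; have := jrate_follow y j u y0 u01.
  by rewrite /al' /al; nra.
apply: integral_pos_mean_lower => // z z0.
rewrite -(addrA T s); apply: le_trans (hN (s - r)%R _ rTm _); last exact: orthant_lead.
by rewrite lee_fin jrate_lead; have := hl z z0; rewrite /al' /al; lra.
Qed.

(* At each state either the bound is already known at all times, or it holds
   initially and [chi + be * s] is a subsolution there. *)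
Lemma comparison A (T Tm : R) (chi : m.-tuple R -> R) (be M : R) :
  measurable A -> (0 <= T)%R ->
  (forall y, orthant y -> (chi y <= M)%R) ->
  (forall y, orthant y ->
     (forall s, (0 <= s <= Tm)%R -> (chi y + be * s)%:E <= P (T + s)%R y A) \/
     ((chi y)%:E <= P T y A /\ drift_ge chi y be)) ->
  forall s y, (0 <= s <= Tm)%R -> orthant y ->
     (chi y + be * s)%:E <= P (T + s)%R y A.
Proof.
move=> mA T0 chiM hchi s y hs y0.
have Tm0 : (0 <= Tm)%R by case/andP: hs; exact: le_trans.
have q1 := jrate_ge1 _ y0.
have Pf : P (T + s)%R y A \is a fin_num by exact: fin_num_measure.
rewrite -(fineK Pf) lee_fin; set p := fine _.
(* At the fixed state [y] the perturbation costs [de * (jrate y + s)], which a small [de] brings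
   below any [ep]. *)
suff hde (de : R) : (0 < de)%R -> (chi y - de * jrate y + (be - de) * s <= p)%R.
  apply/ler_addgt0Pr => ep ep0.
  have d0 : (0 < ep / (jrate y + s + 1))%R by rewrite divr_gt0//; case/andP: hs; lra.
  have := hde _ d0.
  have : (ep / (jrate y + s + 1) * (jrate y + s + 1) = ep)%R.
    by rewrite divfK//; apply: lt0r_neq0; case/andP: hs; lra.
  lra.
move=> de0.
pose K := ((M + `|be| * Tm) / de)%R.
have hK : (M + `|be| * Tm <= de * K)%R by rewrite /K mulrCA mulfV ?mulr1// lt0r_neq0.
pose N0 : R := `|M + `|be| * Tm|%R.
pose rho : R := (1 - expR (- (`|K| * Tm)))%R.
have rho01 : (0 <= rho < 1)%R.
  rewrite /rho subr_ge0 ltrBlDl ltrDr expR_gt0 andbT.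
  by rewrite -expR0 ler_expR oppr_le0 mulr_ge0.
(* Iterate [comparison_step]. The initial deficit [N0] makes the bound nonpositive, and each pass
   multiplies the deficit by [rho < 1]. *)
have hk (k : nat) : forall s y, (0 <= s <= Tm)%R -> orthant y ->
     (chi y - de * jrate y + (be - de) * s - N0 * rho ^+ k)%:E <= P (T + s)%R y A.
  elim: k => [|k IH] s' y' hs' y'0.
    apply: (@le_trans _ _ 0) => //; rewrite lee_fin expr0 mulr1.
    have := chiM _ y'0; have := jrate_ge1 _ y'0; have : (be * s' <= `|be| * Tm)%R.
      case/andP: hs' => s'0 s'T.
      by apply: (le_trans (ler_norm _)); rewrite normrM ler_wpM2l// ger0_norm.
    have := ler_norm (M + `|be| * Tm); rewrite -/N0; case/andP: hs'; nra.
  rewrite exprSr mulrA.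
  apply: (@comparison_step _ _ Tm _ _ M) => //.
    by case/andP: rho01 => r0 _; rewrite mulr_ge0 ?normr_ge0// exprn_ge0.
  by apply: (le_trans hK); rewrite ler_wpM2l ?ler_norm// ltW.
apply/ler_addgt0Pr => ep ep0.
have : (N0 * rho ^+ k @[k --> \oo] --> N0 * 0)%R.
  apply: cvgM; first exact: cvg_cst.
  by apply: cvg_expr; case/andP: rho01 => r0 r1; rewrite ger0_norm.
rewrite mulr0 => /cvgr0Pnorm_lt/(_ _ ep0) [k _ /(_ k (leqnn k))] /= hN.
have := hk k s y hs y0; rewrite -(fineK Pf) lee_fin -/p.
have := ler_norm (N0 * rho ^+ k); lra.
Qed.

End transition.

(** * Coming down from infinity *)

Section lyapunov.
Context {R : realType} {m : nat} (m0 : (0 < m)%N).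
Implicit Types (y : m.-tuple R).

(** Bounded and concave, with slope L / (L + x)^2. The decay in 1 / x^2 is the slowest useful one: a
    gap of size x jumps at rate x over a mean distance x / 2, so the drift stays of order one at
    infinity. *)
Definition satur (L x : R) : R := x / (L + x).

Lemma satur_ge0 (L x : R) : 0 < L -> 0 <= x -> 0 <= satur L x.
Proof. by move=> L0 x0; rewrite /satur divr_ge0//; lra. Qed.

Lemma satur_le1 (L x : R) : 0 < L -> 0 <= x -> satur L x <= 1.
Proof. by move=> L0 x0; rewrite /satur ler_pdivrMr; lra. Qed.

(** By concavity the slope on [0, S] is at least its value at S. Taking S to be the whole span gives
    every partial sum the same slope. *)
Lemma satur_decr (L S x d : R) : 0 < L -> 0 <= d -> d <= x -> x <= S ->
  satur L (x - d) <= satur L x - L * d / (L + S) ^+ 2.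
Proof.
move=> L0 d0 dx xS; rewrite lerBrDr -lerBrDl.
have -> : satur L x - satur L (x - d) = L * d / ((L + x) * (L + (x - d))).
  by rewrite /satur; field; apply/andP; split; apply: lt0r_neq0; lra.
apply: ler_wpM2l; first by rewrite mulr_ge0// ltW.
rewrite lef_pV2 ?posrE ?exprn_gt0 ?mulr_gt0//; try lra.
by rewrite expr2; apply: ler_pM; lra.
Qed.

Lemma satur_incr (L x z : R) : 0 < L -> 0 <= x -> 0 <= z ->
  satur L (x + z) <= satur L x + z / L.
Proof.
move=> L0 x0 z0; rewrite -lerBlDl.
have -> : satur L (x + z) - satur L x = L * z / ((L + x) * (L + (x + z))).
  by rewrite /satur; field; apply/andP; split; apply: lt0r_neq0; lra.
rewrite ler_pdivrMr; last by rewrite mulr_gt0//; lra.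
rewrite mulrAC ler_pdivlMr// -mulrA mulrCA; apply: ler_wpM2l => //.
by apply: ler_pM; lra.
Qed.

Definition lyap (L : R) y : R := \sum_(i < m) satur L (psum y i).

Lemma lyap_ge0 L y : 0 < L -> orthant y -> 0 <= lyap L y.
Proof. by move=> L0 y0; apply: sumr_ge0 => i _; rewrite satur_ge0// psum_ge0. Qed.

Lemma lyap_le L y : 0 < L -> orthant y -> lyap L y <= m%:R.
Proof.
move=> L0 y0; rewrite -[X in X%:R]card_ord -sum1_card natr_sum.
by apply: ler_sum => i _; rewrite satur_le1// psum_ge0.
Qed.

Lemma lyap_follow L y (j : 'I_m) u : 0 < L -> orthant y -> 0 <= u <= 1 ->
  lyap L (follow y j u) <= lyap L y - L * (y`_j * u) / (L + psum y m.-1) ^+ 2.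
Proof.
move=> L0 y0 /andP[u0 u1]; rewrite /lyap (bigD1 j)//= [in leRHS](bigD1 j)//=.
rewrite (eq_bigr (fun i : 'I_m => satur L (psum y i))); last first.
  by move=> i ij; rewrite psum_follow// ifF ?subr0//; apply/negbTE.
have yj := nth_ge0 _ j y0; have := nth_le_psum y j j y0 (leqnn j).
rewrite psum_follow// eqxx addrAC lerD2r => yS.
apply: satur_decr => //; [exact: mulr_ge0|nra|].
by apply: psum_le => //; rewrite -ltnS prednK.
Qed.

Lemma lyap_lead L y z : 0 < L -> orthant y -> 0 < z ->
  lyap L (lead y z) <= lyap L y + m%:R * z / L.
Proof.
move=> L0 y0 z0; rewrite -mulrA mulr_natl -[X in _ *+ X]card_ord -sumr_const -big_split/=.
apply: ler_sum => i _; rewrite psum_lead//; apply: satur_incr => //; last exact: ltW.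
exact: psum_ge0.
Qed.

Lemma psum_sqr_le y : (psum y m.-1) ^+ 2 <= m%:R * \sum_(j < m) y`_j ^+ 2.
Proof.
have -> : psum y m.-1 = \sum_(j < m) y`_j.
  by have := @jrate_psum _ _ y m.-1 (leqnn _); rewrite /jrate => /addrI.
set S := \sum_(j < m) y`_j; have mR : 0 < m%:R :> R by rewrite ltr0n.
pose c := S / m%:R; have hc : S = m%:R * c by rewrite /c mulrC divfK// lt0r_neq0.
have : \sum_(j < m) (2 * c * y`_j - c ^+ 2) <= \sum_(j < m) y`_j ^+ 2.
  by apply: ler_sum => j _; have := sqr_ge0 (y`_j - c); rewrite !expr2; lra.
rewrite sumrB -mulr_sumr -/S sumr_const card_ord -mulr_natl => h.
apply: le_trans (ler_wpM2l (ltW mR) h).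
by rewrite [in leRHS]hc [in leLHS]hc !expr2; lra.
Qed.

(** Let S be the span. From S >= L follows (L + S)^2 <= 4 S^2, and the sum of the squared gaps is at
    least S^2 / m, so the followers contribute at least L / (8 m) = 2. The leader takes back only m
    / L = 1/16. *)
Lemma lyap_drift L y : L = 16 * m%:R -> orthant y -> L <= psum y m.-1 ->
  1 <= \sum_(j < m) y`_j * (L * y`_j / (L + psum y m.-1) ^+ 2 / 2) - m%:R / L.
Proof.
move=> LE y0 LS; have mR : 0 < m%:R :> R by rewrite ltr0n.
have L0 : 0 < L by rewrite LE; lra.
have -> : m%:R / L = 16^-1 :> R.
  by rewrite LE; field; exact: lt0r_neq0.
set S := psum y m.-1 in LS *.
have LS0 : 0 < (L + S) ^+ 2 by rewrite exprn_gt0//; lra.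
rewrite (eq_bigr (fun j : 'I_m => L / (L + S) ^+ 2 / 2 * y`_j ^+ 2)); last first.
  by move=> j _; rewrite expr2; ring.
rewrite -mulr_sumr; have := psum_sqr_le y; rewrite -/S.
set Q := \sum_(j < m) _ => hQ.
suff : 2 <= L / (L + S) ^+ 2 / 2 * Q by lra.
rewrite -mulrA mulrAC ler_pdivlMr// LE mulrA.
have -> : 2^-1 * Q = Q / 2 by rewrite mulrC.
have : (16 * m%:R + S) ^+ 2 <= 4 * S ^+ 2.
  by rewrite -LE; rewrite !expr2; nra.
by move=> ?; lra.
Qed.

End lyapunov.

Section coming_down.
Context {R : realType} {m : nat} (theta : probability R R)
  (P : R -> m.-tuple R -> probability (m.-tuple R) R)
  (m0 : (0 < m)%N) (th0 : theta `]0%R, +oo[%classic = 1%E)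
  (th1 : (\int[theta]_z z%:E = 1)%E) (hP : gap_transition theta P).
Implicit Types (y : m.-tuple R) (A : set (m.-tuple R)).

(** Constants have zero drift, so this is [comparison] with a constant subsolution. *)
Lemma transition_min A (T s a : R) y : measurable A -> 0 <= T -> 0 <= s ->
  (forall z, orthant z -> (a%:E <= P T z A)%E) -> orthant y ->
  (a%:E <= P (T + s) y A)%E.
Proof.
move=> mA T0 s0 ha y0.
suff : ((a + 0 * s)%:E <= P (T + s) y A)%E by rewrite mul0r addr0.
apply: (@comparison _ _ theta P m0 th0 th1 hP A T s (fun=> a) 0 a) => //; last first.
  by rewrite s0 lexx.
move=> z z0; right; split; first exact: ha.
exists (fun=> 0), 0; split=> [j u _|u _|]; rewrite ?mul0r ?addr0 ?subr0//.
by rewrite big1// => j _; rewrite mulr0.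
Qed.

(** Comparison with [a - c' * lyap + c' * s], where [c' = c / (m + 1)]. On the set of small span it
    stays below [a + c] up to time m + 1; off that set [lyap_drift] makes it a subsolution. Since
    [lyap <= m], at time m + 1 it is at least [a + c'] everywhere. *)
Lemma transition_coming_down A (T a c : R) : measurable A -> 0 <= T -> 0 <= c ->
  (forall z, orthant z -> (a%:E <= P T z A)%E) ->
  (forall y s, orthant y -> psum y m.-1 <= 16 * m%:R -> 0 <= s <= m.+1%:R ->
     ((a + c)%:E <= P (T + s) y A)%E) ->
  forall y, orthant y -> ((a + c / m.+1%:R)%:E <= P (T + m.+1%:R) y A)%E.
Proof.
move=> mA T0 c0 ha hc y y0.
have mR : 0 < m%:R :> R by rewrite ltr0n.
pose L : R := 16 * m%:R; have L0 : 0 < L by rewrite /L; lra.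
have m1 : 0 < m.+1%:R :> R by rewrite ltr0n.
pose c' := c / m.+1%:R; have c'0 : 0 <= c' by rewrite divr_ge0// ltW.
have c'E : c' * m.+1%:R = c by rewrite divfK// lt0r_neq0.
have hyp : forall z, orthant z ->
  (forall s, 0 <= s <= m.+1%:R -> ((a - c' * lyap L z + c' * s)%:E <= P (T + s) z A)%E) \/
  ((a - c' * lyap L z)%:E <= P T z A)%E /\ drift_ge (fun z => a - c' * lyap L z) z c'.
  move=> z z0; have W0 := lyap_ge0 L z L0 z0.
  have [zL|Lz] := leP (psum z m.-1) L.
    left=> s /andP[s0 s1]; apply: le_trans (hc z s z0 zL _); last by rewrite s0.
    by rewrite lee_fin -c'E; nra.
  right; split; first by apply: le_trans (ha z z0); rewrite lee_fin; nra.
  exists (fun j => c' * (L * z`_j / (L + psum z m.-1) ^+ 2)), (c' * (m%:R / L)).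
  split=> [j u u01|u u0|].
  - have := lyap_follow m0 L z j u L0 z0 u01 => h.
    have : c' * lyap L (follow z j u) <= c' * (lyap L z - L * (z`_j * u) / (L + psum z m.-1) ^+ 2).
      exact: ler_wpM2l.
    lra.
  - have : c' * lyap L (lead z u) <= c' * (lyap L z + m%:R * u / L).
      by apply: ler_wpM2l => //; exact: lyap_lead.
    lra.
  - have := lyap_drift m0 L z erefl z0 (ltW Lz) => h.
    rewrite (eq_bigr (fun j : 'I_m => c' * (z`_j * (L * z`_j / (L + psum z m.-1) ^+ 2 / 2)))).
      by rewrite -mulr_sumr -mulrBr -[leLHS]mulr1; apply: ler_wpM2l.
    by move=> j _; lra.
apply: le_trans (@comparison _ _ theta P m0 th0 th1 hP A T m.+1%:R
  (fun z => a - c' * lyap L z) c' a mA T0 _ hyp m.+1%:R y _ y0); first last.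
- by rewrite lexx ltW.
- by move=> z z0; rewrite lerBlDr lerDl mulr_ge0// lyap_ge0.
- have := lyap_le L y L0 y0; rewrite lee_fin -/c' -natr1; nra.
Qed.

End coming_down.

(** * Minorization *)

Lemma integral01_cst (R : realType) (a : R) :
  (\int[lebesgue_measure]_(u in `[0%R, 1%R]) a%:E = a%:E)%E.
Proof.
have := integral01_affine R a 0; rewrite mul0r addr0 => e; rewrite -[RHS]e.
by apply: eq_integral => u _; rewrite mul0r addr0.
Qed.

(** * Averages over a cube in the last coordinates *)

Section box_average.
Context {R : realType} {m : nat}.
Implicit Types (y : m.-tuple R) (h : m.-tuple R -> \bar R).

Definition set_coord y (k : nat) (w : R) : m.-tuple R :=
  [tuple (if val i == k then w else tnth y i) | i < m].

(* The mean of [h] when the last [j] coordinates are resampled independently and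
   uniformly on [0, w]; for [j = m] it no longer depends on the state. *)
Fixpoint box_avg (w : R) h (j : nat) : m.-tuple R -> \bar R :=
  if j is j'.+1 then
    fun y => (\int[lebesgue_measure]_(u in `[0%R, 1%R])
                box_avg w h j' (set_coord y (m - j'.+1) (w * u)%R))%E
  else h.

Lemma measurable_set_coord k : measurable_fun setT
  (fun p : m.-tuple R * R => set_coord p.1 k p.2).
Proof.
apply/measurable_fun_tnthP => i.
rewrite (_ : _ \o _ = fun p : m.-tuple R * R => if val i == k then p.2 else tnth p.1 i).
  case: (val i == k); first exact: measurable_snd.
  exact: (measurableT_comp (measurable_tnth i) measurable_fst).
by apply/funext => p; rewrite /= tnth_mktuple.
Qed.

Local Open Scope ereal_scope.

Lemma box_avg_ge0 w h j y : (forall y, 0 <= h y) -> 0 <= box_avg w h j y.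
Proof.
move=> h0; elim: j y => [|j IH] y; first exact: h0.
by apply: integral_ge0 => u _; exact: IH.
Qed.

Lemma measurable_box_avg w h j : (forall y, 0 <= h y) -> measurable_fun setT h ->
  measurable_fun setT (box_avg w h j).
Proof.
move=> h0 mh; elim: j => [|j IH] //=.
apply: measurable_integral_param => //; last by move=> *; exact: box_avg_ge0.
have mg : measurable_fun setT (fun p : m.-tuple R * measurableTypeR R =>
    (p.1, (w * p.2)%R)).
  apply/measurable_fun_pairP; split => /=; first exact: measurable_fst.
  by apply: measurable_funM => //; exact: measurable_snd.
exact: (measurableT_comp IH (measurableT_comp (measurable_set_coord (m - j.+1)) mg)).
Qed.

Lemma measurable_box_avg_coord w h j y k : (forall y, 0 <= h y) ->
  measurable_fun setT h ->
  measurable_fun setT (fun x : R => box_avg w h j (set_coord y k x)).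
Proof.
move=> h0 mh; have mg : measurable_fun setT (fun x : R => (y, x)).
  by apply/measurable_fun_pairP; split; [exact: measurable_cst|exact: measurable_id].
exact: (measurableT_comp (measurable_box_avg w h j h0 mh)
  (measurableT_comp (measurable_set_coord k) mg)).
Qed.

Lemma measurable_box_avg_scale w h j y k (c : R) : (forall y, 0 <= h y) ->
  measurable_fun setT h ->
  measurable_fun setT (fun x : R => box_avg w h j (set_coord y k (c * x)%R)).
Proof.
move=> h0 mh; have mg : measurable_fun setT (fun x : R => (c * x)%R).
  exact: measurable_funM.
exact: (measurableT_comp (measurable_box_avg_coord w h j y k h0 mh) mg).
Qed.

Lemma box_avg_le1 w h j y : (forall y, 0 <= h y) -> (forall y, h y <= 1) ->
  box_avg w h j y <= 1.
Proof.
move=> h0 h1; elim: j y => [|j IH] y //=.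
apply: (@le_trans _ _ (\int[lebesgue_measure]_(u in `[0%R, 1%R]) (1 + 0 * u)%:E)).
  apply: ge0_integral_lower => u _; first by rewrite mul0r addr0.
  by rewrite mul0r addr0.
by rewrite integral01_affine mul0r addr0.
Qed.

Lemma box_avg_fin w h j y : (forall y, 0 <= h y) -> (forall y, h y <= 1) ->
  box_avg w h j y \is a fin_num.
Proof.
move=> h0 h1; rewrite ge0_fin_numE; last exact: box_avg_ge0.
by apply: le_lt_trans (ltry 1); exact: box_avg_le1.
Qed.

(** For the excesses of a set and of its complement: their sum is bounded below pointwise, hence so
    is the sum of their averages. *)
Lemma box_avg_superadd w (h1 h2 : m.-tuple R -> \bar R) (c : R) j y :
  (forall y, 0 <= h1 y) -> (forall y, 0 <= h2 y) ->
  measurable_fun setT h1 -> measurable_fun setT h2 ->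
  (forall y, c%:E <= h1 y + h2 y) ->
  c%:E <= box_avg w h1 j y + box_avg w h2 j y.
Proof.
move=> h10 h20 mh1 mh2 hc; elim: j y => [|j IH] y //=.
rewrite -ge0_integralD//; last 4 first.
- by move=> *; exact: box_avg_ge0.
- by apply: measurable_funTS; exact: measurable_box_avg_scale.
- by move=> *; exact: box_avg_ge0.
- by apply: measurable_funTS; exact: measurable_box_avg_scale.
rewrite -[X in X%:E](_ : (c + 0 / 2 = c)%R); last by rewrite mul0r addr0.
apply: integral01_lower => u; first by rewrite adde_ge0// box_avg_ge0.
by move=> _; rewrite mul0r addr0; exact: IH.
Qed.

(** Resampling forgets the last [j] coordinates. This absorbs both the unknown starting state and
    the gap that grows when a follower jumps. *)
Lemma eq_box_avg w h j y y' : (j <= m)%N ->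
  (forall i : 'I_m, (i < m - j)%N -> tnth y i = tnth y' i) ->
  box_avg w h j y = box_avg w h j y'.
Proof.
elim: j y y' => [|j IH] y y' jm yy' /=.
  by congr h; apply: eq_from_tnth => i; apply: yy'; rewrite subn0.
apply: eq_integral => u _; apply: IH; first exact: ltnW.
move=> i; rewrite !tnth_mktuple; case: ifPn => // ik ij; apply: yy'.
by move: ik ij; rewrite /=; lia.
Qed.

End box_average.

(** * Successive jumps: the leader first, then the followers in order *)

Section minorization.
Context {R : realType} {m : nat} (theta : probability R R)
  (P : R -> m.-tuple R -> probability (m.-tuple R) R)
  (m0 : (0 < m)%N) (th0 : theta `]0%R, +oo[%classic = 1%E)
  (th1 : (\int[theta]_z z%:E = 1)%E) (hP : gap_transition theta P).
Implicit Types (y : m.-tuple R) (A : set (m.-tuple R)).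

(** Hold the level [a] until one unit of time remains, then wait for a jump. A jump within that unit
    gains I (1 - e^(-q)) / q, which is at least I e^(-K). *)
Lemma transition_gain A (T t a I K : R) y : measurable A -> orthant y ->
  0 <= T -> 1 <= t -> 0 <= I -> jrate y <= K ->
  (forall z, orthant z -> (a%:E <= P T z A)%E) ->
  (forall s, t - 1 <= s <= t ->
     ((jrate y * a + I)%:E <= jumpQ theta (fun z => P (T + s)%R z A) y)%E) ->
  ((a + expR (- K) * I)%:E <= P (T + t) y A)%E.
Proof.
move=> mA y0 T0 t1 I0 qK ha hQ; have q1 := jrate_ge1 _ y0.
set q := jrate y in qK hQ q1 *.
have -> : T + t = (T + (t - 1)) + 1 by lra.
have t10 : 0 <= t - 1 by lra.
have hp : (a%:E <= P (T + (t - 1))%R y A)%E.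
  exact: (transition_min theta P m0 th0 th1 hP).
have T10 : 0 <= T + (t - 1) by exact: addr_ge0.
apply: le_trans (@transition_lower _ _ theta P m0 hP A y (T + (t - 1)) 1 a (a + I / q) 0
  mA y0 T10 ler01 hp _); last first.
  move=> r /andP[r0 r1]; rewrite mul0r !addr0 mulrDr (mulrCA q) mulfV ?mulr1; last first.
    by rewrite lt0r_neq0//; lra.
  have -> : T + (t - 1) + 1 - r = T + (t - r) by lra.
  by apply: hQ; apply/andP; split; lra.
rewrite lee_fin -/q !mulr1.
have -> : a + I / q + 0 + expR (- q) * (a - (a + I / q)) = a + I * ((1 - expR (- q)) / q).
  by field; apply: lt0r_neq0; lra.
rewrite lerD2l mulrC; apply: ler_wpM2l => //.
rewrite ler_pdivlMr; last by lra.
have eK : expR (- K) <= expR (- q) by rewrite ler_expR lerN2.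
(* From e^q >= 1 + q one gets 1 - e^(-q) >= q e^(-q). *)
have h1 : expR (- q) * expR q = 1 by rewrite -expRD addNr expR0.
have h2 := expR_ge1Dx q; have h3 := expR_gt0 (- q).
by nra.
Qed.

Section stages.
Context (A : set (m.-tuple R)) (T a z0 w K Tm : R) (mA : measurable A)
  (T0 : 0 <= T) (a0 : 0 <= a)
  (ha : forall z, orthant z -> (a%:E <= P T z A)%E)
  (w0 : 0 < w) (wz : m%:R * w <= z0) (K1 : 0 <= K) (Tm0 : 0 <= Tm).

(** Where [a] is a lower bound this is the plain difference. The truncation keeps it nonnegative off
    the orthant too, where no bound is assumed. *)
Definition excess z : \bar R := (Num.max (fine (P T z A) - a) 0)%:E.

Lemma excess_ge0 z : (0 <= excess z)%E.
Proof. by rewrite lee_fin le_max lexx orbT. Qed.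

Lemma excess_le1 z : (excess z <= 1)%E.
Proof.
have Pf : P T z A \is a fin_num by exact: fin_num_measure.
have h : fine (P T z A) <= 1 by rewrite -lee_fin fineK//; exact: probability_le1.
by rewrite /excess lee_fin ge_max ler01 andbT lerBlDr (le_trans h)// lerDl.
Qed.

Lemma measurable_excess : measurable_fun setT excess.
Proof.
have mP := hP.1 A mA; apply/measurable_EFinP.
apply: measurable_maxr => //; apply: measurable_funB => //.
have mg : measurable_fun setT (fun z : m.-tuple R => (T, z)).
  by apply/measurable_fun_pairP; split; [exact: measurable_cst|exact: measurable_id].
have := measurableT_comp mP mg => /= mPT.
exact: (measurableT_comp (@fine_measurable R setT measurableT) mPT).
Qed.

(** The factor e^(-K Tm) pays for the final wait without a jump. Each follower jump costs e^(-K) by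
    [transition_gain], and [w] is the mass that density 1 puts on [0, w]. *)
Definition gain (j : nat) : R := expR (- (K * Tm)) * (w * expR (- K)) ^+ j.

Lemma gain_gt0 j : 0 < gain j.
Proof. by rewrite mulr_gt0 ?expR_gt0// exprn_gt0// mulr_gt0// expR_gt0. Qed.

Let V j y := fine (box_avg w excess j y).

Let VE j y : (V j y)%:E = box_avg w excess j y.
Proof.
by rewrite fineK//; apply: box_avg_fin => ?; [exact: excess_ge0|exact: excess_le1].
Qed.

Let V_ge0 j y : 0 <= V j y.
Proof. by rewrite -lee_fin VE box_avg_ge0// => ?; exact: excess_ge0. Qed.

(** With probability at least e^(-K Tm) no jump occurs and the excess at [y] is kept; after a jump
    the level [a] is still guaranteed. *)
Lemma stage_base y t : orthant y -> jrate y <= K -> 0 <= t <= Tm ->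
  ((a + gain 0 * V 0 y)%:E <= P (T + t) y A)%E.
Proof.
move=> y0 qK /andP[t0 tT]; have q1 := jrate_ge1 _ y0.
have Pf : P T y A \is a fin_num by exact: fin_num_measure.
have hV : V 0 y = fine (P T y A) - a.
  by rewrite /V/=; apply/max_idPl; have := ha _ y0; rewrite -(fineK Pf) lee_fin; lra.
apply: le_trans (@transition_lower _ _ theta P m0 hP A y T t (fine (P T y A)) a 0
  mA y0 T0 t0 _ _); last first.
- move=> r /andP[r0 rt]; rewrite mul0r !addr0 jrateE mulrDl mul1r mulr_suml addrC.
  have hm z : orthant z -> (a%:E <= P (T + t - r)%R z A)%E.
    by move=> z0'; rewrite -addrA; apply: (transition_min theta P m0 th0 th1 hP) => //; lra.
  apply: jumpQ_lower => //.
    move=> j; rewrite -[X in X%:E](_ : (a + 0 / 2 = a)); last by rewrite mul0r addr0.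
    apply: integral01_lower => // u u01; rewrite mul0r addr0.
    by apply: hm; exact: orthant_follow.
  rewrite -[X in X%:E](addr0 a); apply: integral_pos_mean_lower => // z z0'.
  by rewrite mul0r addr0; apply: hm; exact: orthant_lead.
- by rewrite fineK.
rewrite hV mul0r addr0 lee_fin lerD2l /gain expr0 mulr1; apply: ler_wpM2r.
  by rewrite -hV.
by rewrite ler_expR lerN2; apply: ler_pM => //; lra.
Qed.

(* Follower [k = m - j - 1] jumps: its gap [y`_k >= w] lands in [0, w] with
   density [y`_k * (1 / y`_k) = 1], whatever the state. *)
Lemma stage_step j y t : (j < m)%N -> orthant y -> jrate y <= K ->
  (forall i, (i < m - j.+1)%N -> y`_i <= w) -> z0 <= psum y (m - j.+1) ->
  j.+1%:R <= t <= Tm ->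
  (forall y' s, orthant y' -> jrate y' <= K ->
     (forall i, (i < m - j)%N -> y'`_i <= w) ->
     ((0 < j)%N -> z0 <= psum y' (m - j)) ->
     j%:R <= s <= Tm -> ((a + gain j * V j y')%:E <= P (T + s) y' A)%E) ->
  ((a + gain j.+1 * V j.+1 y)%:E <= P (T + t) y A)%E.
Proof.
move=> jm y0 qK yw zS /andP[jt tT] IH.
pose k := (m - j.+1)%N; have km : (k < m)%N by rewrite /k; lia.
have mj : (m - j = k.+1)%N by rewrite /k; lia.
(* The [k] gaps before it are at most [w], while all [k.+1] together reach [z0 >= m w]; so gap [k]
   is at least [(m - k) w >= w]. *)
have yk : w <= y`_k.
  have : psum y k <= k%:R * w + y`_k.
    rewrite /psum (bigD1 (Ordinal km))//= (tnth_nth 0) addrC lerD2r.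
    rewrite (@le_trans _ _ (\sum_(i < m | (i < k)%N) w))//.
      rewrite [leLHS](eq_bigl (fun i : 'I_m => (i < k)%N)); last first.
        by move=> i; rewrite -val_eqE/=; lia.
      by apply: ler_sum => i ik; rewrite (tnth_nth 0); exact: yw.
    by rewrite (big_ord_narrow (ltnW km)) sumr_const card_ord mulr_natl.
  have : k.+1%:R * w <= m%:R * w by rewrite ler_wpM2r ?(ltW w0)// ler_nat.
  by have wz' := wz; rewrite -natr1 mulrDl mul1r; move: zS; rewrite -/k; lra.
have yk0 : 0 < y`_k by apply: lt_le_trans yk.
pose G (x : R) : \bar R :=
  (box_avg w excess j (set_coord y k x) * (\1_(`[0, w]%classic : set R) x)%:E)%E.
have G0 x : (0 <= G x)%E.
  by rewrite mule_ge0 ?lee_fin// box_avg_ge0// => ?; exact: excess_ge0.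
have mG : measurable_fun setT G.
  apply: emeasurable_funM.
    by apply: measurable_box_avg_coord; [exact: excess_ge0|exact: measurable_excess].
  by apply/measurable_EFinP; exact: measurable_indic.
have GI : ((w * V j.+1 y)%:E <=
    (y`_k)%:E * \int[lebesgue_measure]_(u in `[0%R, 1%R]) G (y`_k * (1 - u))%R)%E.
  have mGs : measurable_fun setT (fun u : R => G (y`_k * u)%R).
    by apply: (measurableT_comp mG); exact: measurable_funM.
  rewrite -(@ge0_integral_onem _ (fun u => G (y`_k * u)%R))//.
  rewrite -ge0_integral_scale//.
  apply: (@le_trans _ _ (\int[lebesgue_measure]_(x in `[0%R, w]) G x)%E); last first.
    apply: ge0_subset_integral => //; first exact: measurable_funTS.
    by apply: subset_itvl; rewrite bnd_simp.
  rewrite ge0_integral_scale// EFinM VE/= -/k; apply: lee_wpmul2l.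
    by rewrite lee_fin ltW.
  have w0' := w0; apply: ge0_integral_lower => // u; rewrite /= in_itv/= => /andP[u0 u1].
  by rewrite /G indicE mem_set ?mule1//= in_itv/=; apply/andP; split; nra.
have gj : gain j.+1 = expR (- K) * (gain j * w).
  by rewrite /gain exprS; ring.
rewrite gj -(mulrA (expR (- K))) -(mulrA (gain j)); apply: transition_gain => //.
- by apply: le_trans jt; rewrite ler1n.
- by rewrite mulr_ge0 ?(ltW (gain_gt0 j))// mulr_ge0// ltW.
move=> s /andP[s1 s2].
have jsT : j%:R <= s <= Tm.
  by apply/andP; split; [rewrite -natr1 in jt|]; lra.
have s0 : 0 <= s by case/andP: jsT => + _; apply: le_trans; rewrite ler0n.
have hm z : orthant z -> (a%:E <= P (T + s)%R z A)%E.
  by move=> z0'; apply: (transition_min theta P m0 th0 th1 hP).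
(* Only the jump of follower [k] is credited with a gain; every other jump is bounded by the level
   [a]. *)
pose I_ (i : 'I_m) := if val i == k then a + gain j * (w * V j.+1 y) / y`_k else a.
apply: (@le_trans _ _ (\sum_(i < m) y`_i * I_ i + a)%:E).
  rewrite lee_fin jrateE (bigD1 (Ordinal km))//= [in leRHS](bigD1 (Ordinal km))//=.
  rewrite [in leRHS](eq_bigr (fun i : 'I_m => y`_i * a)); last first.
    by move=> i ik; rewrite /I_ ifF//; apply/negbTE.
  have e : y`_k * (gain j * (w * V j.+1 y) / y`_k) = gain j * (w * V j.+1 y).
    by rewrite mulrC divfK// lt0r_neq0.
  by rewrite -mulr_suml /I_/= eqxx mulrDr e; lra.
apply: jumpQ_lower => //; last first.
  rewrite -[X in X%:E](addr0 a); apply: integral_pos_mean_lower => // z z0'.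
  by rewrite mul0r addr0; apply: hm; exact: orthant_lead.
move=> i; rewrite /I_; case: ifPn => [/eqP ik|ik]; last first.
  rewrite -[X in X%:E](_ : (a + 0 / 2 = a)); last by rewrite mul0r addr0.
  apply: integral01_lower => // u u01; rewrite mul0r addr0.
  by apply: hm; exact: orthant_follow.
rewrite ik.
apply: (@le_trans _ _ (\int[lebesgue_measure]_(u in `[0%R, 1%R])
    (a%:E + (gain j)%:E * G (y`_k * (1 - u))%R))%E).
  have mGr : measurable_fun setT (fun u : R => G (y`_k * (1 - u))%R).
    apply: (measurableT_comp mG); apply: measurable_funM => //.
    exact: measurable_funB.
  rewrite ge0_integralD//; last first.
  - by apply: measurable_funTS; apply: emeasurable_funM.
  - by move=> u _; rewrite mule_ge0// lee_fin (ltW (gain_gt0 j)).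
  rewrite ge0_integralZl//; last first.
  - by rewrite lee_fin (ltW (gain_gt0 j)).
  - exact: measurable_funTS.
  rewrite EFinD; apply: leeD.
    by rewrite integral01_cst.
  rewrite -mulrA EFinM; apply: lee_wpmul2l; first by rewrite lee_fin (ltW (gain_gt0 j)).
  by rewrite mulrC EFinM lee_pdivrMl.
apply: ge0_integral_lower => // u; rewrite /= in_itv/= => u01.
rewrite /G indicE; have [|_] := boolP (_ \in _); last first.
  by rewrite mule0 mule0 adde0; apply: hm; exact: orthant_follow.
rewrite inE/= in_itv/= mule1 => /andP[x0 xw].
(* The jump also enlarges gap [k.+1], but [box_avg] at level [j] resamples all coordinates from
   [m - j = k.+1] on. *)
have -> : box_avg w excess j (set_coord y k (y`_k * (1 - u))) =
    box_avg w excess j (follow y k u).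
  apply: eq_box_avg; first exact: ltnW.
  move=> i' i'k; rewrite !tnth_mktuple; case: ifPn => [/eqP i'E|i'n].
    by rewrite (tnth_nth 0) i'E; lra.
  by rewrite ifF ?addr0//; apply: ltn_eqF; rewrite -mj.
rewrite -VE -EFinM -EFinD; apply: IH => //.
- exact: orthant_follow.
- by apply: le_trans qK; exact: (jrate_follow m0 y (Ordinal km)).
- move=> i' i'k; have i'm : (i' < m)%N by rewrite mj in i'k; apply: leq_trans i'k _.
  rewrite -(tnth_nth 0 (follow y k u) (Ordinal i'm)) tnth_mktuple (tnth_nth 0)/=.
  have [i'E|i'n] := eqVneq i' k; first by rewrite i'E; lra.
  rewrite ifF ?addr0; last by apply: ltn_eqF; rewrite -mj.
  by apply: yw; rewrite -/k ltn_neqAle i'n -ltnS -mj.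
- move=> j0; rewrite mj psum_follow// ?ifF ?subr0; last 2 first.
  + exact: gtn_eqF.
  + by rewrite -mj ltn_subrL j0 m0.
  by apply: (le_trans zS); apply: psum_le.
Qed.

(** Here [j] counts the followers still to jump, one unit of time for each. The bound on [psum] is
    guarded by [0 < j] because the jump of the last follower lowers the total span. *)
Lemma stages j y t : (j <= m)%N -> orthant y -> jrate y <= K ->
  (forall i, (i < m - j)%N -> y`_i <= w) ->
  ((0 < j)%N -> z0 <= psum y (m - j)) -> j%:R <= t <= Tm ->
  ((a + gain j * V j y)%:E <= P (T + t) y A)%E.
Proof.
elim: j y t => [|j IH] y t jm y0 qK yw zS tT; first exact: stage_base.
apply: stage_step => //; first exact: zS.
by move=> y' s y'0 qK' yw' zS' sT; apply: IH => //; exact: ltnW.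
Qed.

(** The leader jumps at rate 1 whatever the state. A jump in [z0, z1] makes every partial sum at
    least [z0] and keeps the rate below [K]. The average [V m] is the same before and after, since
    it ignores the state. *)
Lemma stage_leader (z1 : R) y t : orthant y -> jrate y + z1 <= K -> 0 < z0 -> z0 <= z1 ->
  m.+1%:R <= t <= Tm ->
  ((a + expR (- K) * (gain m * V m y * fine (theta `[z0, z1]%classic)))%:E
    <= P (T + t)%R y A)%E.
Proof.
move=> y0 qK z00 z01 /andP[mt tT].
set D : set R := `[z0, z1]%classic.
have mD : measurable D by exact: measurable_itv.
have thD : theta D \is a fin_num by exact: fin_num_measure.
have gV0 : 0 <= gain m * V m y by rewrite mulr_ge0// ltW// gain_gt0.
apply: transition_gain => //.
- by apply: le_trans mt; rewrite ler1n.
- by rewrite mulr_ge0// fine_ge0.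
- by lra.
move=> s /andP[s1 s2].
have msT : m%:R <= s <= Tm.
  by apply/andP; split; [rewrite -natr1 in mt|]; lra.
have s0 : 0 <= s by case/andP: msT => + _; apply: le_trans; rewrite ler0n.
have hm z : orthant z -> (a%:E <= P (T + s)%R z A)%E.
  by move=> z0'; apply: (transition_min theta P m0 th0 th1 hP).
apply: (@le_trans _ _ (\sum_(i < m) y`_i * a +
    (a + gain m * V m y * fine (theta D)))%:E).
  by rewrite lee_fin jrateE -mulr_suml; lra.
apply: jumpQ_lower => //.
  move=> j; rewrite -[X in X%:E](_ : (a + 0 / 2 = a)); last by rewrite mul0r addr0.
  apply: integral01_lower => // u u01; rewrite mul0r addr0.
  by apply: hm; exact: orthant_follow.
set E : set R := `]0, +oo[%classic.
have mE : measurable E by exact: measurable_itv.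
have DE : D `<=` E.
  by move=> z; rewrite /D /E /= !in_itv/= andbT => /andP[+ _]; exact: lt_le_trans.
apply: (@le_trans _ _ (\int[theta]_(z in E)
    (a%:E + (gain m * V m y)%:E * (\1_D z)%:E))%E).
  rewrite ge0_integralD//; last first.
  - by apply: emeasurable_funM => //; apply/measurable_EFinP; exact: measurable_indic.
  - by move=> z _; rewrite mule_ge0// lee_fin.
  rewrite ge0_integralZl//; last by apply/measurable_EFinP; exact: measurable_indic.
  rewrite (integral_cst _ mE) integral_indic// (setIidl DE) [X in (_ * X + _)%E]th0 mule1.
  by rewrite EFinD EFinM fineK.
apply: (@le_trans _ _ (\int[theta]_(z in E) P (T + s)%R (lead y z) A)%E); last first.
  rewrite integral_mkcond; apply: ge0_integral_lower => // z _.
  by rewrite patchE; case: ifP => _ //; exact: measure_ge0.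
apply: ge0_integral_lower => // z; rewrite /E/= in_itv/= andbT => zpos.
rewrite indicE; have [|_] := boolP (z \in D); last first.
  by rewrite mule0 adde0; apply: hm; exact: orthant_lead.
rewrite inE /D/= in_itv/= mule1 => /andP[zz0 zz1].
have -> : V m y = V m (lead y z).
  by rewrite /V; congr fine; apply: eq_box_avg => // i; rewrite subnn.
apply: stages => //.
- exact: orthant_lead.
- by rewrite jrate_lead//; lra.
- by move=> i; rewrite subnn.
- by move=> _; rewrite subnn psum_lead//; have := psum_ge0 y 0 y0; lra.
Qed.

End stages.

End minorization.

(** * Geometric ergodicity *)

(** The open half-line is the countable union of the intervals [1/(n+1), n+1], which cannot all be
    null. *)
Lemma exists_mass_itv (R : realType) (theta : probability R R) :
  theta `]0%R, +oo[%classic = 1%E ->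
  exists z0 z1 : R, [/\ 0 < z0, z0 <= z1 & 0 < fine (theta `[z0, z1]%classic)].
Proof.
move=> th0; apply: contrapT => /forallNP H.
pose F (n : nat) : set R := `[n.+1%:R^-1, n.+1%:R]%classic.
have mF n : measurable (F n) by exact: measurable_itv.
have F0 n : theta (F n) = 0%E.
  have Ff : theta (F n) \is a fin_num by exact: fin_num_measure.
  apply: contrapT => Fn; apply: (H n.+1%:R^-1); exists n.+1%:R; split.
  - by rewrite invr_gt0 ltr0n.
  - by rewrite (@le_trans _ _ 1)// ?invf_le1 ?ltr0n// ler1n.
  - rewrite lt_neqAle fine_ge0// andbT eq_sym; apply/eqP => h; apply: Fn.
    by rewrite -(fineK Ff) h.
have : theta.-negligible (\bigcup_n F n).
  apply: negligible_bigcup => n; apply/negligibleP; [exact: mF|exact: F0].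
have sub : `]0%R, +oo[%classic `<=` \bigcup_n F n.
  move=> x; rewrite /= in_itv/= andbT => x0.
  exists (maxn (Num.bound x) (Num.bound x^-1)) => //.
  rewrite /F/= in_itv/=; apply/andP; split.
    rewrite -[leRHS]invrK lef_pV2 ?posrE ?invr_gt0 ?ltr0n//.
    apply: (le_trans (ltW (archi_boundP _))); first by rewrite invr_ge0 ltW.
    by rewrite ler_nat (leq_trans (leq_maxr (Num.bound x) _)).
  apply: (le_trans (ltW (archi_boundP (ltW x0)))).
  by rewrite ler_nat (leq_trans (leq_maxl (Num.bound x) (Num.bound x^-1))).
move=> /(negligibleS sub)/measure_negligible => /(_ (measurable_itv _)).
by move=> h; have := th0; rewrite [LHS]h => /eqP; rewrite eq_sym onee_eq0.
Qed.

Lemma measurable_orthant (R : realType) (m : nat) : measurable (@orthant R m).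
Proof.
have -> : @orthant R m = \bigcap_(i in [set: 'I_m]) ((fun y => tnth y i) @^-1` `[0%R, +oo[%classic).
  apply/seteqP; split => y /=.
    by move=> y0 i _; rewrite /= in_itv/= andbT.
  by move=> y0 i; have := y0 i I; rewrite /= in_itv/= andbT.
apply: fin_bigcap_measurable => // i _.
rewrite -[X in measurable X]setTI; apply: measurable_tnth => //.
Qed.

Section ergodicity.
Context {R : realType} {m : nat} (theta : probability R R)
  (P : R -> m.-tuple R -> probability (m.-tuple R) R)
  (m0 : (0 < m)%N) (th0 : theta `]0%R, +oo[%classic = 1%E)
  (th1 : (\int[theta]_z z%:E = 1)%E) (hP : gap_transition theta P).
Implicit Types (y : m.-tuple R) (A : set (m.-tuple R)).

(** The minorization on the set of small span, carried to all states by [transition_coming_down]. As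
    [box_avg] at level [m] is independent of the state, [y0] is arbitrary. *)
Lemma doeblin : exists eps w T0 : R, [/\ 0 < eps, eps < 1, 0 < T0 &
  forall A T a y0, measurable A -> 0 <= T -> 0 <= a ->
    (forall z, orthant z -> (a%:E <= P T z A)%E) ->
    forall y, orthant y ->
      ((a + eps * fine (box_avg w (excess P A T a) m y0))%:E <= P (T + T0) y A)%E].
Proof.
have [z0 [z1 [z00 z01 thD]]] := exists_mass_itv _ _ th0.
have mR : 0 < m%:R :> R by rewrite ltr0n.
have m1R : 0 < m.+1%:R :> R by rewrite ltr0n.
pose w := z0 / m%:R; have w0 : 0 < w by rewrite divr_gt0.
have wz : m%:R * w <= z0 by rewrite /w mulrC divfK// lt0r_neq0.
(* [K] bounds the rate after a leader jump of at most [z1] from span at most 16 m. [Tm] adds the m +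
   1 units for the jumps to the m + 1 units for coming down. *)
pose K : R := 1 + 16 * m%:R + z1; have K0 : 0 <= K by rewrite /K; lra.
pose Tm : R := m.+1%:R + m.+1%:R; have Tm0 : 0 <= Tm by rewrite /Tm; lra.
set D := fine _ in thD.
pose c : R := expR (- K) * (gain w K Tm m * D) / m.+1%:R.
have g0 := gain_gt0 w K Tm w0 m.
have c0 : 0 < c by rewrite divr_gt0// mulr_gt0 ?expR_gt0// mulr_gt0.
exists (Num.min c 2^-1), w, Tm; split.
- by rewrite lt_min c0/=; lra.
- by rewrite gt_min; apply/orP; right; lra.
- by rewrite /Tm; lra.
move=> A T a y0 mA T0 a0 ha y yo.
have h0 z : (0 <= excess P A T a z)%E by exact: excess_ge0.
have h1 z : (excess P A T a z <= 1)%E by apply: excess_le1.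
set V := fine _.
have V0 : 0 <= V by rewrite fine_ge0// box_avg_ge0.
have T10 : 0 <= T + m.+1%:R by rewrite addr_ge0// ltW.
have ha1 z : orthant z -> (a%:E <= P (T + m.+1%:R) z A)%E.
  by move=> zo; apply: (transition_min theta P m0 th0 th1 hP) => //; exact: ltW.
have C0 : 0 <= expR (- K) * (gain w K Tm m * V * D).
  by rewrite mulr_ge0 ?expR_ge0// mulr_ge0 ?(ltW thD)// mulr_ge0// ltW.
have := @transition_coming_down _ _ theta P m0 th0 th1 hP A (T + m.+1%:R) a
  (expR (- K) * (gain w K Tm m * V * D)) mA T10 C0 ha1 _ y yo.
rewrite -addrA -/Tm => H; apply: le_trans (H _).
  have cV : Num.min c 2^-1 * V <= c * V by rewrite ler_wpM2r// ge_min lexx.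
  have -> : expR (- K) * (gain w K Tm m * V * D) / m.+1%:R = c * V by rewrite /c; ring.
  by rewrite lee_fin lerD2l.
move=> z s zo zL /andP[s0 s1].
have -> : V = fine (box_avg w (excess P A T a) m z).
  by congr fine; apply: eq_box_avg => // i; rewrite subnn.
rewrite -(addrA T); apply: (stage_leader theta P m0 th0 th1 hP) => //.
- by rewrite (@jrate_psum _ _ z m.-1)// /K lerD2r lerD2l.
- by rewrite /Tm; apply/andP; split; lra.
Qed.

(** * Decay of the oscillation of the transition probabilities *)

Lemma transition_setC A t y : measurable A ->
  P t y (~` A) = (1 - fine (P t y A))%:E.
Proof.
move=> mA; have Pf : P t y A \is a fin_num by exact: fin_num_measure.
by rewrite probability_setC// EFinB fineK.
Qed.

Definition osc_within A (t a b : R) : Prop :=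
  [/\ 0 <= a, b <= 1 &
    forall y, orthant y -> a <= fine (P t y A) <= b].

(** An upper bound for [A] is a lower bound for its complement, so only lower bounds have to be
    propagated. *)
Lemma osc_withinP A (t a b : R) : measurable A -> 0 <= a -> b <= 1 ->
  osc_within A t a b <-> (forall y, orthant y -> (a%:E <= P t y A)%E) /\
                         (forall y, orthant y -> ((1 - b)%:E <= P t y (~` A))%E).
Proof.
move=> mA a0 b1; have Pf y : P t y A \is a fin_num by exact: fin_num_measure.
split=> [[_ _ H]|[H1 H2]].
  split=> y /H /andP[h1 h2]; first by rewrite -(fineK (Pf y)) lee_fin.
  by rewrite transition_setC// lee_fin; lra.
split=> // y yo; have := H1 y yo; have := H2 y yo.
rewrite transition_setC// -(fineK (Pf y)) !lee_fin /= => h1 h2.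
by apply/andP; split; lra.
Qed.

Lemma osc_within_later A (t s a b : R) : measurable A -> 0 <= t -> 0 <= s ->
  osc_within A t a b -> osc_within A (t + s) a b.
Proof.
move=> mA t0 s0 H; have [a0 b1 _] := H.
move/(osc_withinP _ _ _ _ mA a0 b1): H => [H1 H2].
have mAC : measurable (~` A) by exact: measurableC.
by apply/osc_withinP => //; split=> y yo;
  apply: (transition_min theta P m0 th0 th1 hP).
Qed.

(** The excesses of [A] over [a] and of its complement over [1 - b] add up to at least [b - a] at
    every state, hence so do their averages [V1] and [V2]. By [doeblin] the two ends move inwards by
    [eps * V1] and [eps * V2]. *)
Lemma osc_contraction : exists eps T0 : R, [/\ 0 < eps, eps < 1, 0 < T0 &
  forall A t a b, measurable A -> 0 <= t -> osc_within A t a b ->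
    exists a' b', osc_within A (t + T0) a' b' /\ b' - a' <= (1 - eps) * (b - a)].
Proof.
have [eps [w [T0 [e0 e1 T00 H]]]] := doeblin.
exists eps, T0; split=> // A t a b mA t0 hab; have [a0 b1 _] := hab.
move/(osc_withinP _ _ _ _ mA a0 b1): hab => [H1 H2].
have mAC : measurable (~` A) by exact: measurableC.
have b10 : 0 <= 1 - b by lra.
pose y0 : m.-tuple R := [tuple 0 | i < m].
pose h1 := excess P A t a; pose h2 := excess P (~` A) t (1 - b).
have h10 z : (0 <= h1 z)%E by exact: excess_ge0.
have h20 z : (0 <= h2 z)%E by exact: excess_ge0.
pose V1 := fine (box_avg w h1 m y0); pose V2 := fine (box_avg w h2 m y0).
have V10 : 0 <= V1 by rewrite fine_ge0// box_avg_ge0.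
have V20 : 0 <= V2 by rewrite fine_ge0// box_avg_ge0.
have V12 : b - a <= V1 + V2.
  rewrite -lee_fin [in X in (_ <= X)%E]EFinD /V1 /V2 !fineK; first last.
  - by apply: box_avg_fin => // z; apply: excess_le1.
  - by apply: box_avg_fin => // z; apply: excess_le1.
  apply: box_avg_superadd => //.
  - exact: (measurable_excess theta P hP).
  - exact: (measurable_excess theta P hP).
  move=> z; rewrite /h1 /h2 /excess transition_setC//= -EFinD lee_fin.
  set p := fine _.
  have : p - a <= Num.max (p - a) 0 by rewrite le_max lexx.
  have : 1 - p - (1 - b) <= Num.max (1 - p - (1 - b)) 0 by rewrite le_max lexx.
  lra.
have := H A t a y0 mA t0 a0 H1; rewrite -/h1 -/V1 => L1.
have := H (~` A) t (1 - b) y0 mAC t0 b10 H2; rewrite -/h2 -/V2 => L2.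
exists (a + eps * V1), (b - eps * V2); split; last by nra.
have a'0 : 0 <= a + eps * V1 by rewrite addr_ge0// mulr_ge0// ltW.
have b'1 : b - eps * V2 <= 1.
  by have := mulr_ge0 (ltW e0) V20; lra.
apply/osc_withinP => //; split=> y yo; first exact: L1.
have -> : 1 - (b - eps * V2) = 1 - b + eps * V2 by lra.
exact: L2.
Qed.

Lemma osc_decay : exists eps T0 : R, [/\ 0 < eps, eps < 1, 0 < T0 &
  forall A (k : nat), measurable A ->
    exists a b, osc_within A (k%:R * T0) a b /\ b - a <= (1 - eps) ^+ k].
Proof.
have [eps [T0 [e0 e1 T00 H]]] := osc_contraction.
exists eps, T0; split=> // A k mA.
elim: k => [|k [a [b [hab hk]]]].
  exists 0, 1; split; last by rewrite expr0 subr0.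
  apply/osc_withinP => //; split=> y yo; first exact: measure_ge0.
  by rewrite subrr; exact: measure_ge0.
have kT : 0 <= k%:R * T0 by rewrite mulr_ge0// ltW.
have [a' [b' [hab' h]]] := H A _ a b mA kT hab.
exists a', b'; split; first by rewrite -natr1 mulrDl mul1r.
by apply: (le_trans h); rewrite exprS ler_wpM2l//; lra.
Qed.

(** Lower bounds valid on the orthant integrate against [pi], which has full mass there; this is
    applied to [A] and to its complement. *)
Lemma stationary_within (pi : probability (m.-tuple R) R) A (t a b : R) :
  stationary P pi -> measurable A -> 0 <= t -> osc_within A t a b ->
  a <= fine (pi A) <= b.
Proof.
move=> [piO hpi] mA t0 hab; have [a0 b1 _] := hab.
have mO := @measurable_orthant R m.
have mAC : measurable (~` A) by exact: measurableC.
have low (B : set (m.-tuple R)) (c : R) : measurable B ->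
    (forall y, orthant y -> (c%:E <= P t y B)%E) -> (c%:E <= pi B)%E.
  move=> mB hc; rewrite -(hpi t B t0 mB).
  apply: (@le_trans _ _ (\int[pi]_(y in @orthant R m) P t y B)%E).
    have -> : c%:E = (\int[pi]_(y in @orthant R m) c%:E)%E.
      by rewrite (integral_cst _ mO) [X in (_ * X)%E]piO mule1.
    by apply: ge0_integral_lower => // y yo; exact: measure_ge0.
  rewrite integral_mkcond; apply: ge0_integral_lower => // y _.
  by rewrite patchE; case: ifP => _ //; exact: measure_ge0.
have pif : pi A \is a fin_num by exact: fin_num_measure.
move/(osc_withinP _ _ _ _ mA a0 b1): hab => [H1 H2].
have := low _ _ mA H1; have := low _ _ mAC H2.
rewrite probability_setC// -(fineK pif) -EFinB !lee_fin /= => h1 h2.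
by apply/andP; split; lra.
Qed.

Lemma geometric_ergodicity (pi : probability (m.-tuple R) R) :
  stationary P pi ->
  exists kappa beta : R, 0 < kappa /\ 0 < beta < 1 /\
    forall t : R, 0 < t -> (sup_tv P pi t <= (kappa * beta `^ t)%:E)%E.
Proof.
move=> hpi; have [eps [T0 [e0 e1 T00 H]]] := osc_decay.
pose rho := 1 - eps; have rho0 : 0 < rho by rewrite /rho; lra.
have rho1 : rho < 1 by rewrite /rho; lra.
have lr : ln rho < 0 by rewrite ln_lt0// rho0.
(* Here [beta] is rho^(1/T0). With [k] the integer part of t / T0, one has k > t / T0 - 1, so rho^k
   is at most rho^(-1) beta^t; this gives [kappa]. *)
exists rho^-1, (expR (ln rho / T0)); split; first by rewrite invr_gt0.
split.
  by rewrite expR_gt0/= -expR0 ltr_expR pmulr_llt0// invr_gt0.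
move=> t t0; apply: ge_ereal_sup => _ [y [A [yo [mA ->]]]].
set k := Num.truncn (t / T0).
have tT0 : 0 <= t / T0 by rewrite divr_ge0// ltW.
have /andP[k1 k2] := truncn_itv tT0; rewrite -/k in k1 k2.
have kT : k%:R * T0 <= t by rewrite -ler_pdivlMr.
have [a [b [hab hk]]] := H A k mA.
have kT0 : 0 <= k%:R * T0 by rewrite mulr_ge0// ltW.
have ts : 0 <= t - k%:R * T0 by lra.
have := osc_within_later _ _ _ _ _ mA kT0 ts hab.
rewrite addrC subrK => hab'; have [_ _ /(_ y yo)] := hab'.
have := stationary_within pi A t a b hpi mA (ltW t0) hab'.
have Pf : P t y A \is a fin_num by exact: fin_num_measure.
have pif : pi A \is a fin_num by exact: fin_num_measure.
rewrite -(fineK Pf) -(fineK pif) /=.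
move=> /andP[p1 p2] /andP[q1 q2].
rewrite lee_fin; apply: (@le_trans _ _ (rho ^+ k)).
  by apply: le_trans hk; rewrite ler_norml; apply/andP; split; lra.
have -> : rho ^+ k = expR (k%:R * ln rho) by rewrite expRM_natl lnK.
have -> : rho^-1 = expR (- ln rho) by rewrite expRN lnK.
rewrite -expRM -expRD ler_expR; rewrite -natr1 in k2.
rewrite mulrAC -mulrA; nra.
Qed.

End ergodicity.

Theorem theorem3p2 (R : realType) (n : nat) (theta : probability R R)
  (P : R -> (n.-1).-tuple R -> probability ((n.-1).-tuple R) R)
  (pi : probability ((n.-1).-tuple R) R) :
  (2 <= n)%N ->
  theta `]0%R, +oo[%classic = 1%E ->
  (\int[theta]_z z%:E = 1)%E ->
  gap_transition theta P ->
  stationary P pi ->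
  exists kappa beta : R, 0 < kappa /\ 0 < beta < 1 /\
    forall t : R, 0 < t ->
      (sup_tv P pi t <= (kappa * beta `^ t)%:E)%E.
Proof.
move=> n2 th0 th1 hP hpi.
have m0 : (0 < n.-1)%N by case: n n2 {P pi hP hpi} => [|[]].
exact: (geometric_ergodicity theta P m0 th0 th1 hP).
Qed.
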